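(* Let $\mathcal{M}$ be a family of nonzero finitely generated abelian groups such that at least one $N\in\mathcal{M}$ has nonzero torsion part, and put $M=\prod\mathcal{M}$ and $S=\bigoplus\mathcal{M}$. Then the following conditions are equivalent: (1) $M$ is self-small; (2) $S$ is $\mathbb{Z}$-small and $S_{(p)}$-small for all $p\in\mathbb{P}$; (3) $S_{(p)}$ is finite for each $p\in\mathbb{P}$ and $S/T_S$ is finitely generated; (4) there are only finitely many $A\in\mathcal{M}$ which are infinite, and for each $p\in\mathbb{P}$ there are only finitely many $A\in\mathcal{M}$ with $A_{(p)}\neq 0$; (5) the family $\{B\in\mathcal{M}\mid \mathrm{Hom}(B,A)\neq 0\}$ is finite for each $A\in\mathcal{M}$; (6) there are only finitely many $A\in\mathcal{M}$ which are infinite, and the family $\{B\in\mathcal{M}\mid \mathrm{Hom}(C,B)\neq 0\}$ is finite for each finite $C\in\mathcal{M}$; (7) $M\cong F\oplus\prod_{p\in\mathbb{P}}M_p$ for some finitely generated free abelian group $F$ and some finite abelian $p$-groups $M_p$, one for each $p\in\mathbb{P}$.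
   Context: All groups are abelian. $\mathbb{P}$ is the set of all prime numbers. A family of groups may contain more than one copy of a group (i.e. it is an indexed family), and finiteness of subfamilies is counted with multiplicity (by index). For an abelian group $A$, $T_A=\bigoplus_{p\in\mathbb{P}}A_{(p)}$ denotes the torsion part of $A$, where $A_{(p)}$ is the $p$-component of the torsion part. For an abelian group $A$ and a class $\mathcal{C}$ of abelian groups, $A$ is called $\mathcal{C}$-small if for every family $(N_i)_{i\in I}$ ($I$ any set, repetitions allowed) of groups belonging to $\mathcal{C}$ the canonical injective homomorphism $\bigoplus_{i\in I}\mathrm{Hom}(A,N_i)\to\mathrm{Hom}(A,\bigoplus_{i\in I}N_i)$, $(f_i)_i\mapsto\sum_i f_i$, is an isomorphism. For an abelian group $B$, $A$ is called $B$-small if it is $\{B\}$-small, i.e. $\bigoplus_{i\in I}\mathrm{Hom}(A,B)\to\mathrm{Hom}(A,B^{(I)})$ is an isomorphism for every set $I$, where $B^{(I)}$ is the direct sum of $I$ copies of $B$. $A$ is self-small if it is $A$-small. *)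

(* Defs.v *)
From HB Require Import structures.
From mathcomp Require Import all_boot all_algebra.
From mathcomp Require Import boolp classical_sets functions cardinality.

Set Implicit Arguments.
Unset Strict Implicit.
Unset Printing Implicit Defensive.

Import GRing.Theory.
Local Open Scope classical_set_scope.
Local Open Scope ring_scope.

Section Product.
Variables (I : Type) (N : I -> zmodType).

Definition gprod : Type := forall i, N i.

HB.instance Definition _ := Choice.copy gprod (forall i, N i).

Let zero : gprod := fun=> 0.
Let opp (x : gprod) : gprod := fun i => - x i.
Let add (x y : gprod) : gprod := fun i => x i + y i.

Fact gprod_addA : associative add.
Proof. by move=> x y z; apply: functional_extensionality_dep => i; exact: addrA. Qed.

Fact gprod_addC : commutative add.
Proof. by move=> x y; apply: functional_extensionality_dep => i; exact: addrC. Qed.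

Fact gprod_add0 : left_id zero add.
Proof. by move=> x; apply: functional_extensionality_dep => i; exact: add0r. Qed.

Fact gprod_addN : left_inverse zero opp add.
Proof. by move=> x; apply: functional_extensionality_dep => i; exact: addNr. Qed.

HB.instance Definition _ :=
  GRing.isZmodule.Build gprod gprod_addA gprod_addC gprod_add0 gprod_addN.

Lemma gprodBE (x y : gprod) i : (x - y) i = x i - y i.
Proof. by []. Qed.

Definition fin_supp : {pred gprod} :=
  fun x => `[< finite_set [set i | x i != 0] >].

Fact fin_supp_zmod_closed : zmod_closed fin_supp.
Proof.
split=> [|x y /asboolP xf /asboolP yf]; apply/asboolP.
  by rewrite [X in finite_set X](_ : _ = set0) // -subset0 => i /=; rewrite eqxx.
apply: (@sub_finite_set _ _ ([set i | x i != 0] `|` [set i | y i != 0])).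
  move=> i /= xyi; have [xi|xi] := eqVneq (x i) 0; [right|by left].
  by apply: contra xyi => /eqP yi; rewrite gprodBE xi yi subr0.
by rewrite finite_setU.
Qed.

HB.instance Definition _ := GRing.isZmodClosed.Build gprod fin_supp
  fin_supp_zmod_closed.

Definition dsum : Type := {x : gprod | x \in fin_supp}.

HB.instance Definition _ := SubChoice.on dsum.
HB.instance Definition _ := [SubChoice_isSubZmodule of dsum by <:].

End Product.

Section HomGroup.
Variables A B : zmodType.

Lemma additive_inj (f g : {additive A -> B}) : f =1 g -> f = g.
Proof.
case: f g => [f [[cf]]] [g [[cg]]] /= /funext fg; subst g.
by rewrite (Prop_irrelevance cf cg).
Qed.

HB.instance Definition _ := gen_eqMixin {additive A -> B}.
HB.instance Definition _ := gen_choiceMixin {additive A -> B}.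

Let zero : {additive A -> B} := \0.
Let opp (f : {additive A -> B}) : {additive A -> B} := \- f.
Let add (f g : {additive A -> B}) : {additive A -> B} := f \+ g.

Fact hom_addA : associative add.
Proof. by move=> f g h; apply: additive_inj => x /=; rewrite addrA. Qed.

Fact hom_addC : commutative add.
Proof. by move=> f g; apply: additive_inj => x /=; rewrite addrC. Qed.

Fact hom_add0 : left_id zero add.
Proof. by move=> f; apply: additive_inj => x /=; rewrite add0r. Qed.

Fact hom_addN : left_inverse zero opp add.
Proof. by move=> f; apply: additive_inj => x /=; rewrite addNr. Qed.

HB.instance Definition _ := GRing.isZmodule.Build {additive A -> B}
  hom_addA hom_addC hom_add0 hom_addN.

Definition hom_group : zmodType := {additive A -> B}.

End HomGroup.

Section Canonical.
Variables (A : zmodType) (I : Type) (N : I -> zmodType).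

Section Fun.
Variable f : dsum (fun i => hom_group A (N i)).

Let coords (a : A) : gprod N := fun i => (val f i : {additive A -> N i}) a.

Fact coords_fin_supp a : coords a \in @fin_supp I N.
Proof.
apply/asboolP; have /asboolP := valP f; apply: sub_finite_set => i /=.
apply: contra => /eqP fi; apply/eqP.
exact: (congr1 (fun h : {additive A -> N i} => h a) fi).
Qed.

Definition dsum_hom_fun (a : A) : dsum N := exist _ (coords a) (coords_fin_supp a).

Fact dsum_hom_fun_is_zmod_morphism : zmod_morphism dsum_hom_fun.
Proof.
move=> a b; apply: val_inj; apply: functional_extensionality_dep => i.
by rewrite /= /coords raddfB.
Qed.

HB.instance Definition _ :=
  GRing.isZmodMorphism.Build A (dsum N) dsum_hom_fun dsum_hom_fun_is_zmod_morphism.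

End Fun.

(* The canonical map (f_i)_i |-> \sum_i f_i.  The i-th coordinate of
   (\sum_i f_i) a is f_i a, because f_i is viewed as a map into the i-th summand. *)
Definition dsum_hom (f : dsum (fun i => hom_group A (N i))) : hom_group A (dsum N) :=
  dsum_hom_fun f.

Fact dsum_hom_is_zmod_morphism : zmod_morphism dsum_hom.
Proof.
move=> f g; apply: additive_inj => a; apply: val_inj.
exact: functional_extensionality_dep.
Qed.

HB.instance Definition _ := GRing.isZmodMorphism.Build
  (dsum (fun i => hom_group A (N i))) (hom_group A (dsum N)) dsum_hom dsum_hom_is_zmod_morphism.

Lemma dsum_hom_inj : injective dsum_hom.
Proof.
move=> f g fg; apply: val_inj; apply: functional_extensionality_dep => i.
by apply: additive_inj => a; have /(congr1 (fun h : {additive A -> dsum N} => val (h a) i)) := fg.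
Qed.

End Canonical.

Definition class_small (A : zmodType) (C : zmodType -> Prop) : Prop :=
  forall (I : Type) (N : I -> zmodType),
    (forall i, C (N i)) -> bijective (@dsum_hom A I N).

Definition small (A B : zmodType) : Prop := class_small A (fun N => N = B).

Definition self_small (A : zmodType) : Prop := small A A.

Lemma smallP (A B : zmodType) :
  small A B <-> forall I : Type, bijective (@dsum_hom A I (fun=> B)).
Proof.
split=> [sAB I|sAB I N NB]; first exact: sAB.
by have -> : N = fun=> B by apply: funext.
Qed.

Section Torsion.
Variable A : zmodType.

Definition torsion : {pred A} :=
  fun x => `[< exists2 n : nat, (0 < n)%N & x *+ n = 0 >].

Fact torsion_zmod_closed : zmod_closed torsion.
Proof.
split=> [|x y /asboolP[m m0 xm] /asboolP[n n0 yn]]; apply/asboolP.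
  by exists 1%N.
exists (m * n)%N; first by rewrite muln_gt0 m0.
by rewrite mulrnBl mulrnA xm mul0rn mulnC mulrnA yn mul0rn subr0.
Qed.

HB.instance Definition _ := GRing.isZmodClosed.Build A torsion torsion_zmod_closed.

Variable p : nat.

Definition p_torsion : {pred A} := fun x => `[< exists k : nat, x *+ (p ^ k) = 0 >].

Fact p_torsion_zmod_closed : zmod_closed p_torsion.
Proof.
split=> [|x y /asboolP[m xm] /asboolP[n yn]]; apply/asboolP.
  by exists 0%N.
exists (m + n)%N.
by rewrite expnD mulrnBl mulrnA xm mul0rn mulnC mulrnA yn mul0rn subr0.
Qed.

HB.instance Definition _ :=
  GRing.isZmodClosed.Build A p_torsion p_torsion_zmod_closed.

Definition torsion_part : Type := {x : A | x \in torsion}.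
HB.instance Definition _ := SubChoice.on torsion_part.
HB.instance Definition _ := [SubChoice_isSubZmodule of torsion_part by <:].

Definition p_component : Type := {x : A | x \in p_torsion}.
HB.instance Definition _ := SubChoice.on p_component.
HB.instance Definition _ := [SubChoice_isSubZmodule of p_component by <:].

Definition p_group : Prop := forall x : A, x \in p_torsion.

End Torsion.

Definition torsion_quotient (A : zmodType) : zmodType := Quotient.quot (@torsion A).

Definition nonzero (A : zmodType) : Prop := exists x : A, x != 0.

Definition finite_group (A : zmodType) : Prop := finite_set [set: A].

Definition finitely_generated (A : zmodType) : Prop :=
  exists (n : nat) (g : 'I_n -> A),
    forall x : A, exists c : 'I_n -> int, x = \sum_(i < n) g i *~ c i.

Definition isomorphic (A B : zmodType) : Prop :=
  exists f : {additive A -> B}, bijective f.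

Definition free_abelian (A : zmodType) : Prop :=
  exists J : Type, isomorphic A (dsum (fun _ : J => int)).

(* Main.v *)
Require Import Defs.
From HB Require Import structures.
From mathcomp Require Import all_boot all_algebra.
From mathcomp Require Import zify.
From mathcomp Require Import boolp classical_sets functions cardinality.
Import GRing.Theory Num.Theory.
Local Open Scope classical_set_scope.
Local Open Scope ring_scope.

Set Implicit Arguments.
Unset Strict Implicit.
Unset Printing Implicit Defensive.

(** All conditions are compared with the finiteness condition: only finitely
    many members of the family are infinite, and for each prime [p] only
    finitely many have [p]-torsion.

    Smallness is used in the form of [small_iff_pointwise_finite]: a family of
    homomorphisms [h j : A -> B] such that [h j a] is nonzero for only finitely
    many [j], whatever [a], has only finitely many nonzero members.  A finitely generated
    [A] always has this property.

    A finitely generated group that is infinite, or that has [p]-torsion, maps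
    onto the prime field ([fg_infinite_hom_Fp], [fg_hom_Fp]), and the prime
    field embeds into every group with [p]-torsion ([hom_from_Fp]).  Composing
    the two produces nonzero homomorphisms between members of the family, which
    handles the conditions on Hom groups and, with the coordinate projections,
    the conditions on the direct sum [S].

    For the product [M] projections alone do not suffice, since an element of
    [M] can have infinitely many nonzero coordinates.  If infinitely many [N i]
    map onto the field with [p] elements by [phi i], then the homomorphism
    [(x_i) |-> (phi i x_i)] on [S] extends to all of [M] with values still in
    the direct sum of copies of the field: this is a Zorn argument over vector
    spaces ([hom_extension]).  When [M] has [p]-torsion, the coordinates of the
    extension contradict self-smallness ([self_small_gprod_finite_Fp]).  The
    torsion hypothesis supplies one prime for which this applies, which bounds
    the number of infinite members.

    Conversely, under the finiteness condition each [N i] splits as a free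
    group times its primary components ([fg_structure]), and regrouping the
    factors gives [M = F * prod_p M_p] ([finiteness_decomposition]).  Such a
    group is self-small: [P = prod_p M_p] has no nonzero map to [int], and an
    endomorphism of [P] acts on each factor [M_p] separately, because the other
    factors are [p]-divisible.  If infinitely many [h j] were nonzero on [P],
    choosing one coordinate of [x] in each [M_p] would give a single [x] with
    infinitely many of the [h j x] nonzero ([primary_product_pointwise_finite]). *)

(** * Subgroups, torsion and coordinates *)

Definition additive_of (A B : zmodType) (f : A -> B) (fB : zmod_morphism f) :
    {additive A -> B} :=
  HB.pack f (GRing.isZmodMorphism.Build A B f fB).

Definition to_dsum (I : Type) (N : I -> zmodType) (x : gprod N)
  (xs : x \in @fin_supp I N) : dsum N := exist _ x xs.

Definition to_p_component (A : zmodType) p (x : A) (xp : x \in @p_torsion A p) :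
  p_component A p := exist _ x xp.

Definition subgroup (A : zmodType) (P : set A) : Prop :=
  P 0 /\ forall x y, P x -> P y -> P (x - y).

Section Subgroup.
Variables (A : zmodType) (P : set A).
Hypothesis sP : subgroup P.

Lemma subgroupN x : P x -> P (- x).
Proof. by rewrite -sub0r => Px; apply: sP.2 => //; exact: sP.1. Qed.

Lemma subgroupD x y : P x -> P y -> P (x + y).
Proof. by move=> Px Py; rewrite -[y]opprK; apply: sP.2 => //; exact: subgroupN. Qed.

Lemma subgroupMn x n : P x -> P (x *+ n).
Proof.
by move=> Px; elim: n => [|n IH]; [exact: sP.1|rewrite mulrS; exact: subgroupD].
Qed.

Lemma subgroupMz x (n : int) : P x -> P (x *~ n).
Proof.
move=> Px; case: n => n; first exact: subgroupMn.
by rewrite NegzE mulrNz; apply: subgroupN; exact: subgroupMn.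
Qed.

Lemma subgroup_sum (J : finType) (F : J -> A) :
  (forall j, P (F j)) -> P (\sum_j F j).
Proof.
by move=> PF; elim/big_rec: _ => [|j x _]; [exact: sP.1|exact: subgroupD].
Qed.

End Subgroup.

Lemma subgroup_preim (A B : zmodType) (f : {additive A -> B}) (P : set B) :
  subgroup P -> subgroup [set x | P (f x)].
Proof.
by move=> sP; split=> [|x y /= Px Py]; rewrite /= ?raddf0 ?raddfB;
  [exact: sP.1|exact: sP.2].
Qed.

Lemma torsionP (A : zmodType) (x : A) :
  x \in @torsion A <-> exists2 n : nat, (0 < n)%N & x *+ n = 0.
Proof. by split=> /asboolP. Qed.

Lemma p_torsionP (A : zmodType) p (x : A) :
  x \in @p_torsion A p <-> exists k : nat, x *+ (p ^ k) = 0.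
Proof. by split=> /asboolP. Qed.

Lemma torsion_subgroup (A : zmodType) : subgroup [set x : A | x \in @torsion A].
Proof. by split=> [|x y xt yt] /=; [exact: rpred0|exact: rpredB]. Qed.

Lemma nonzero_p_componentP (A : zmodType) p :
  nonzero (p_component A p) <-> exists2 x : A, x != 0 & x *+ p = 0.
Proof.
split=> [[[x xt] /eqP x0]|[x x0 xp]].
  have {x0}: x != 0 by apply/eqP => /= xx; apply: x0; apply: val_inj.
  have /p_torsionP [k xk] := xt.
  elim: k x {xt} xk => [x|k IH x]; first by rewrite mulr1n => ->; rewrite eqxx.
  rewrite expnS mulrnA => xk x0; have [xp|xp] := eqVneq (x *+ p) 0; first by exists x.
  exact: (IH (x *+ p)).
have xt : x \in @p_torsion A p by apply/p_torsionP; exists 1%N; rewrite expn1.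
by exists (to_p_component xt); apply: contra x0 => /eqP /(congr1 val) /= ->.
Qed.

Lemma nonzero_hom_groupP (A B : zmodType) :
  nonzero (hom_group A B) <-> exists (f : {additive A -> B}) a, f a != 0.
Proof.
split=> [[f /eqP f0]|[f [a fa]]].
  apply: contrapT => H; apply: f0; apply: additive_inj => a.
  by apply: contrapT => fa; apply: H; exists f, a; apply/eqP.
by exists f; apply: contra fa => /eqP ->.
Qed.

(** A homomorphism from [A] to a direct sum of copies of [B] is the same as a
    family of homomorphisms [h j : A -> B] that is finite at every point, and it
    comes from the direct sum of Hom groups exactly when almost all [h j]
    vanish.  Families compose and restrict without any casts on direct sums. *)
Lemma small_iff_pointwise_finite (A B : zmodType) :
  small A B <->
  forall (J : Type) (h : J -> {additive A -> B}),
    (forall a, finite_set [set j | h j a != 0]) ->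
    finite_set [set j | exists a, h j a != 0].
Proof.
rewrite smallP; split=> [sAB J h hfin|H J].
  have hs a : (fun j => h j a) \in @fin_supp J (fun=> B) by apply/asboolP.
  have hB : zmod_morphism (fun a => to_dsum (hs a)).
    move=> a b; apply: val_inj; apply: functional_extensionality_dep => j.
    exact: raddfB.
  have [g _ gK] := sAB J.
  pose f := g (additive_of hB).
  have fE j a : (val f j : {additive A -> B}) a = h j a.
    by have /(congr1 (fun u : {additive A -> dsum _} => val (u a) j)) := gK (additive_of hB).
  have /asboolP := valP f; apply: sub_finite_set => j [a] /=; rewrite -fE.
  apply: contra => /eqP fj; apply/eqP.
  exact: (congr1 (fun u : {additive A -> B} => u a) fj).
have surj (u : hom_group A (dsum (fun _ : J => B))) : exists f, dsum_hom f = u.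
  have hB j : zmod_morphism (fun a => val ((u : {additive A -> _}) a) j).
    by move=> a b; rewrite raddfB.
  have hs : (fun j => additive_of (hB j) : hom_group A B)
      \in @fin_supp J (fun=> hom_group A B).
    apply/asboolP; apply: (sub_finite_set _ (H J (fun j => additive_of (hB j)) _)).
      move=> j /= /eqP j0; apply: contrapT => H0; apply: j0; apply: additive_inj => b.
      by apply: contrapT => b0; apply: H0; exists b; apply/eqP.
    by move=> a; have /asboolP := valP ((u : {additive A -> _}) a).
  exists (to_dsum hs); apply: additive_inj => a; apply: val_inj.
  exact: functional_extensionality_dep.
exists (fun u => projT1 (cid (surj u))).
  by move=> f; case: cid => g /= /dsum_hom_inj.
by move=> u; case: cid.
Qed.

Lemma finite_set_range (T : Type) (X : set T) : finite_set X ->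
  exists n (s : 'I_n -> T), X `<=` range s.
Proof.
move=> Xfin; have [s sX] := (finite_seqP (X : set {classic T})).1 Xfin.
exists (size s), (tnth (in_tuple s)) => x; rewrite sX /= => xs.
by have /tnthP [k xk] : (x : {classic T}) \in in_tuple s; [|exists k].
Qed.

Section Single.
Variables (I : Type) (N : I -> zmodType).

(** The transport along [i = j] makes this work for an index type without
    decidable equality. *)
Definition gsingle i (a : N i) : gprod N := fun j =>
  if pselect (i = j) is left e then eq_rect i (fun k => N k : Type) a j e else 0.

Lemma gsingleE i a : gsingle a i = a.
Proof.
by rewrite /gsingle; case: pselect => // e; rewrite (Prop_irrelevance e erefl).
Qed.

Lemma gsingle_neq i j (a : N i) : i <> j -> gsingle a j = 0.
Proof. by rewrite /gsingle; case: pselect. Qed.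

Fact gsingle_zmod_morphism i : zmod_morphism (@gsingle i).
Proof.
move=> a b; apply: functional_extensionality_dep => j; rewrite gprodBE.
by have [<-|ij] := pselect (i = j); rewrite ?gsingleE ?gsingle_neq ?subr0.
Qed.

HB.instance Definition _ i :=
  GRing.isZmodMorphism.Build (N i) (gprod N) (@gsingle i) (@gsingle_zmod_morphism i).

Fact gsingle_fin_supp i (a : N i) : gsingle a \in @fin_supp I N.
Proof.
apply/asboolP; apply: (@sub_finite_set _ _ [set i]) => // j /= /eqP aj.
by apply: contrapT => ji; apply: aj; rewrite gsingle_neq // => /esym.
Qed.

Definition dsingle i (a : N i) : dsum N := to_dsum (gsingle_fin_supp a).

Fact dsingle_zmod_morphism i : zmod_morphism (@dsingle i).
Proof. by move=> a b; apply: val_inj; exact: raddfB. Qed.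

HB.instance Definition _ i :=
  GRing.isZmodMorphism.Build (N i) (dsum N) (@dsingle i) (@dsingle_zmod_morphism i).

Fact gproj_zmod_morphism i : zmod_morphism (fun x : gprod N => x i).
Proof. by []. Qed.

Definition gproj i : {additive gprod N -> N i} := additive_of (gproj_zmod_morphism i).

Fact dproj_zmod_morphism i : zmod_morphism (fun x : dsum N => val x i).
Proof. by []. Qed.

Definition dproj i : {additive dsum N -> N i} := additive_of (dproj_zmod_morphism i).

Lemma dsingleE i (a : N i) : dproj i (dsingle a) = a.
Proof. exact: gsingleE. Qed.

Lemma gprod_split (x : gprod N) i : gsingle (x i) + (x - gsingle (x i)) = x.
Proof. by rewrite addrC subrK. Qed.

Lemma dsum_ind (P : set (dsum N)) :
  subgroup P -> (forall i (a : N i), P (dsingle a)) -> forall x, P x.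
Proof.
move=> sP Ps x.
have /asboolP /finite_set_range [n [s sE]] := valP x.
have {sE} : forall i, val x i != 0 -> exists k, s k = i.
  by move=> i /sE [k]; exists k.
elim: n s x => [|n IH] s x sx.
  suff -> : x = 0 by exact: sP.1.
  apply: val_inj; apply: functional_extensionality_dep => i /=.
  by apply: contrapT => /eqP /sx [[]].
rewrite -(subrK (dsingle (dproj (s ord0) x)) x).
apply: subgroupD => //; apply: (IH (fun k => s (lift ord0 k))) => i.
have -> : val (x - dsingle (dproj (s ord0) x)) i
   = val x i - gsingle (val x (s ord0)) i by [].
have [<-|si] := pselect (s ord0 = i); first by rewrite gsingleE subrr eqxx.
rewrite gsingle_neq // subr0 => /sx [k ki].
case: (unliftP ord0 k) ki => [k' -> <-|-> /si //]; by exists k'.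
Qed.

End Single.

(** * Homomorphisms to and from the prime field *)

Lemma mulrn_gcd (A : zmodType) (x : A) m n :
  x *+ m = 0 -> x *+ n = 0 -> x *+ gcdn m n = 0.
Proof.
have [->|m0] := posnP m; first by rewrite gcd0n.
move=> xm xn; have [a _ /dvdnP [q qE]] := Bezoutl n m0.
have : x *+ (gcdn m n + a * n) = 0 by rewrite qE mulnC mulrnA xm mul0rn.
by rewrite mulrnDr mulnC mulrnA xn mul0rn addr0.
Qed.

Lemma mulrn_coprime (A : zmodType) (x : A) m n :
  coprime m n -> x *+ m = 0 -> x *+ n = 0 -> x = 0.
Proof. by move=> /eqP mn xm xn; have := mulrn_gcd xm xn; rewrite mn. Qed.

Lemma prime_bezout p n : prime p -> ~~ (p %| n)%N ->
  exists a q, (1 + a * n = q * p)%N.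
Proof.
move=> pp pn; have [a _ /dvdnP [q]] := Bezoutl n (prime_gt0 pp).
have /eqP -> : coprime p n by rewrite prime_coprime.
by exists a, q.
Qed.

(** [f] is defined on a group [G] over [A], and can be extended to [A] as soon as
    it kills everything that becomes divisible by [p].  Let [K] be maximal among
    the subgroups that contain [p A] and meet the image of [G] only in values at
    which [f] vanishes; since [A / p A] is a vector space, [K] and the image of
    [G] then span [A], and the extension is taken to be zero on [K].  The last clause of
    [hom_extension], that the extension takes no new values, keeps values of
    finite support when [f] goes to a product. *)
Section Extension.
Variables (p : nat) (G A U : zmodType) (i : {additive G -> A}) (f : {additive G -> U}).
Hypotheses (pp : prime p) (f0 : forall g a, i g = a *+ p -> f g = 0).

Let admissible (K : set A) := [/\ forall x y, K x -> K y -> K (x - y),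
  forall x a, K x -> K (x + a *+ p) & forall g, K (i g) -> f g = 0].

Lemma hom_extension :
  exists r : {additive A -> U},
    (forall g, r (i g) = f g) /\ (forall x, exists g, r x = f g).
Proof.
have [F FP Ftot|K [[KB Kp Kf] Kmax]] := @Zorn_bigcup A admissible.
  split=> [x y [X FX Xx] [Y FY Yy]|x a [X FX Xx]|g [X FX Xx]].
  - have [XY|YX] := Ftot X Y FX FY.
      by exists Y => //; have [YB _ _] := FP Y FY; apply: YB => //; exact: XY.
    by exists X => //; have [XB _ _] := FP X FX; apply: XB => //; exact: YX.
  - by exists X => //; have [_ Xp _] := FP X FX; exact: Xp.
  - by have [_ _ Xf] := FP X FX; exact: Xf.
(* The empty set is admissible, being the union of the empty chain, but it is
   not maximal: it lies strictly below [p A]. *)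
have [k0 Kk0] : exists k, K k.
  apply: contrapT => K0.
  apply: (Kmax (range (fun a : A => a *+ p))); first split.
  - by move=> k Kk; case: K0; exists k.
  - by move=> H; apply: K0; exists (0 *+ p); apply: H; exists 0.
  split=> [_ _ [x _ <-] [y _ <-]|_ a [x _ <-]|g [a _ /esym/f0 //]].
  - by exists (x - y); rewrite // mulrnBl.
  - by exists (x + a); rewrite // mulrnDl.
have K0 : K 0 by rewrite -(subrr k0); exact: KB.
have KN x : K x -> K (- x) by move=> Kx; rewrite -sub0r; exact: KB.
have KMn x n : K x -> K (x *+ n).
  move=> Kx; elim: n => [//|n IH]; rewrite mulrS -[x *+ n]opprK.
  by apply: KB => //; exact: KN.
have cover v : exists g, K (v - i g).
  apply: contrapT => nv.
  (* The subgroup generated by [K] and [v]; natural multiples of [v] suffice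
     because [p v] belongs to [K]. *)
  pose K' x := exists n, K (x - v *+ n).
  apply: (Kmax K'); first split.
  - by move=> x Kx; exists 0%N; rewrite subr0.
  - move=> K'K; apply: nv; exists 0; rewrite raddf0 subr0; apply: K'K.
    by exists 1%N; rewrite mulr1n subrr.
  split=> [x y [n xn] [m ym]|x a [n xn]|g [n gn]].
  - exists (n + p.-1 * m)%N.
    have -> : x - y - v *+ (n + p.-1 * m) =
        (x - v *+ n) - (y - v *+ m) + (- (v *+ m)) *+ p.
      have -> : (n + p.-1 * m = n + (m * p - m))%N.
        by rewrite -subn1 mulnBl mul1n mulnC.
      rewrite mulrnDr mulrnBr ?leq_pmulr ?prime_gt0 // mulrnA mulNrn.
      by rewrite !opprD !opprK !addrA [LHS]addrAC; congr (_ + _ + _); exact: addrAC.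
    by apply: (Kp); apply: (KB).
  - by exists n; rewrite addrAC; exact: Kp.
  - have [/dvdnP [m nE]|pn] := boolP (p %| n)%N.
      by apply: Kf; rewrite -(subrK (v *+ n) (i g)) nE mulrnA; apply: Kp; rewrite -mulrnA -nE.
    have [a [q aq]] := prime_bezout pp pn.
    case: nv; exists (- (g *+ a)); rewrite raddfN opprK raddfMn.
    have -> : v + i g *+ a = (i g - v *+ n) *+ a + (v *+ q) *+ p.
      rewrite mulrnBl -!mulrnA -aq mulrnDr mulr1n [(n * a)%N]mulnC.
      by rewrite addrACA addNr addr0 addrC.
    by apply: Kp; exact: KMn.
pose s v := projT1 (cid (cover v)).
have sP v : K (v - i (s v)) by rewrite /s; case: cid.
have fs v g : K (v - i g) -> f (s v) = f g.
  move=> vg; apply/eqP; rewrite -subr_eq0 -raddfB; apply/eqP/Kf.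
  rewrite raddfB (_ : _ - _ = (v - i g) - (v - i (s v))); first exact: KB.
  by rewrite opprB [RHS]addrC addrA subrK.
have rB : zmod_morphism (fun v => f (s v)).
  move=> a b; rewrite -raddfB; apply: fs.
  rewrite raddfB (_ : _ - _ = (a - i (s a)) - (b - i (s b))); first exact: KB.
  by rewrite !opprD !opprK !addrA; congr (_ + _); exact: addrAC.
exists (additive_of rB); split=> [g|v]; last by exists (s v).
by apply: fs; rewrite subrr.
Qed.

End Extension.

Section PrimeField.
Variables (p : nat) (A : zmodType).
Hypothesis pp : prime p.

(** The class of [a] in the vector space [A / p A] is nonzero, so some linear
    form does not vanish on it. *)
Lemma hom_to_Fp (a : A) : (forall b, b *+ p <> a) ->
  exists f : {additive A -> 'F_p}, f a != 0.
Proof.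
move=> ap.
have iB : zmod_morphism (fun n : int => a *~ n) by move=> m n; exact: mulrzBr.
have fB : zmod_morphism (fun n : int => n%:~R : 'F_p) by move=> m n; exact: intrB.
have key n b : a *+ n = b *+ p -> (n%:R : 'F_p) = 0.
  move=> ab; apply/eqP; rewrite -(dvdn_pcharf (pchar_Fp pp)).
  apply: contraT => pn; have [u [q uq]] := prime_bezout pp pn.
  exfalso; apply: (ap (a *+ q - b *+ u)).
  by rewrite mulrnBl -mulrnA -uq mulrnDr mulr1n mulrnAC -ab -mulrnA [(u * n)%N]mulnC addrK.
(* The form is prescribed on the cyclic subgroup generated by [a], seen as the
   image of [int]. *)
have [|r [rf _]] := @hom_extension p int A _ (additive_of iB) (additive_of fB) pp.
  move=> [n|n] b /=; first exact: key.
  rewrite NegzE !mulrNz => /(congr1 -%R); rewrite opprK -mulNrn => /key kn.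
  by apply/eqP; rewrite oppr_eq0; apply/eqP.
by exists r; have /= := rf 1; rewrite !mulr1z => ->; exact: oner_neq0.
Qed.

Lemma hom_from_Fp (y : A) : y != 0 -> y *+ p = 0 ->
  exists f : {additive 'F_p -> A}, forall c, c != 0 -> f c != 0.
Proof.
move=> y0 yp.
have ymod n : y *+ (n %% p) = y *+ n.
  by rewrite [in RHS](divn_eq n p) mulrnDr mulnC mulrnA yp mul0rn add0r.
have yD (c d : 'F_p) : y *+ (c + d)%R = y *+ c + y *+ d.
  by rewrite /= -mulrnDr -[RHS]ymod; congr (_ *+ (_ %% _)); exact: Fp_cast.
have yB : zmod_morphism (fun c : 'F_p => y *+ c).
  by move=> c d; apply/eqP; rewrite eq_sym subr_eq -yD subrK.
exists (additive_of yB) => c c0; apply: contra y0 => /eqP /= yc.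
apply/eqP; apply: mulrn_coprime yp yc.
rewrite prime_coprime // gtnNdvd ?lt0n //.
by rewrite -[X in (_ < X)%N](Fp_cast pp) ltn_ord.
Qed.

End PrimeField.

(** * Finitely generated groups *)

Lemma torsionMz (A : zmodType) (x : A) (c : int) :
  c != 0 -> x *~ c \in @torsion A -> x \in @torsion A.
Proof.
move=> c0 /torsionP [n n0 xc]; apply/torsionP; exists (`|c| * n)%N.
  by rewrite muln_gt0 n0 absz_gt0 c0.
case: c c0 xc => [c|c] _; first by rewrite mulrnA.
by rewrite NegzE mulrNz mulNrn => /eqP; rewrite oppr_eq0 => /eqP; rewrite -mulrnA.
Qed.

Lemma hom_int_torsion (A : zmodType) (f : {additive A -> int}) x :
  x \in @torsion A -> f x = 0.
Proof.
move=> /torsionP [n n0 /(congr1 f)]; rewrite raddfMn raddf0 => /eqP.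
by rewrite mulrn_eq0 eqn0Ngt n0 => /eqP.
Qed.

Section GenModTorsion.
Variable A : zmodType.

Definition gen_mod_torsion n (g : 'I_n -> A) : Prop :=
  forall x, exists c : 'I_n -> int, x - \sum_i g i *~ c i \in @torsion A.

(** One step of the Euclidean algorithm, by subtraction; [s] is a sign. *)
Lemma subtractive_step (a b : int) : b != 0 -> (`|b| <= `|a|)%N ->
  exists s : int, (absz (a - s * b)%R < absz a)%N.
Proof.
move=> b0 ba; have [ab|ab] := boolP ((0 <= a) == (0 <= b)); [exists 1|exists (-1)]; lia.
Qed.

(** A generating family modulo torsion of least length is a basis modulo
    torsion.  Given a relation modulo torsion with two nonzero coefficients, a
    Euclidean step applied to the coefficients and the inverse step applied to
    the generators makes the relation smaller, until one coefficient is left;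
    its generator is then a torsion element and could be dropped, against
    minimality. *)
Lemma gen_mod_torsion_indep n (g : 'I_n -> A) (c : 'I_n -> int) :
  (forall m (h : 'I_m -> A), gen_mod_torsion h -> (n <= m)%N) ->
  gen_mod_torsion g -> \sum_i g i *~ c i \in @torsion A -> forall i, c i = 0.
Proof.
move=> nmin.
have [m] := ubnP (\sum_i `|c i|)%N; elim: m g c => // m IH g c cm gg gc.
have key i j : i != j -> c j != 0 -> (`|c j| <= `|c i|)%N -> False.
  move=> ij cj0 cji; have [s sP] := subtractive_step cj0 cji.
  (* Elementary operation: [s] times [g i] is added to [g j], which subtracts [s]
     times the coefficient of [g j] from the coefficient of [g i]. *)
  pose g' l := g l + (if l == j then g i *~ s else 0).
  pose T (d : 'I_n -> int) l := d l - (if l == i then s * d j else 0).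
  have gT d : \sum_l g' l *~ T d l = \sum_l g l *~ d l.
    rewrite (bigD1 i) // (bigD1 j) 1?eq_sym //= [RHS](bigD1 i) // [in RHS](bigD1 j) 1?eq_sym //=.
    rewrite !addrA; congr (_ + _); last first.
      by apply: eq_bigr => l /andP[li lj]; rewrite /g' /T (negPf li) (negPf lj) addr0 subr0.
    rewrite /g' /T !eqxx (negPf ij) eq_sym (negPf ij) addr0 subr0.
    by rewrite mulrzBr mulrzDl -mulrzA addrACA addNr addr0.
  suff : T c j = 0 by move/eqP; rewrite /T [j == i]eq_sym (negPf ij) subr0 (negPf cj0).
  apply: (IH g' (T c)); last by rewrite gT.
    move: cm; rewrite ltnS; apply: leq_trans; rewrite (bigD1 i) //= [X in (_ < X)%N](bigD1 i) //=.
    rewrite -addSn leq_add //; first by rewrite /T eqxx.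
    by apply: leq_sum => l li; rewrite /T (negPf li) subr0.
  by move=> x; have [d dP] := gg x; exists (T d); rewrite gT.
move=> i; apply/eqP; apply: contraT => ci0; exfalso.
have cj j : j != i -> c j = 0.
  move=> ji; apply/eqP; apply: contraT => cj0; exfalso.
  have [cji|cij] := leqP `|c j| `|c i|; first by apply: (key i j); rewrite // eq_sym.
  exact: (key j i ji ci0 (ltnW cij)).
have gi : g i \in @torsion A.
  apply: (torsionMz ci0); move: gc; rewrite (bigD1 i) //= big1 ?addr0 // => j ji.
  by rewrite cj // mulr0z.
case: n nmin g c {IH cm key cj ci0 gc} i gg gi => [_ _ _ []//|n nmin g _ i gg gi].
suff : gen_mod_torsion (fun l => g (lift i l)) by move/nmin; rewrite ltnn.
move=> x; have [d dP] := gg x; exists (fun l => d (lift i l)).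
move: dP; rewrite (bigD1_ord i) //= opprD addrA addrAC => dP.
by rewrite -[X in X \in _](subrK (g i *~ d i)) rpredD // rpredMz.
Qed.

End GenModTorsion.

Section FinitelyGenerated.
Variable A : zmodType.
Hypothesis fgA : finitely_generated A.

(** The splitting of a finitely generated group into a free part with basis [b]
    and dual basis [chi], and the torsion subgroup, onto which [tau] projects.
    A projection is kept rather than a decomposition so that all later maps are
    defined on the whole group. *)
Lemma fg_split : exists k (b : 'I_k -> A) (chi : 'I_k -> {additive A -> int})
    (tau : {additive A -> A}),
  [/\ forall x, tau x \in @torsion A,
      forall t, t \in @torsion A -> tau t = t,
      forall x, x = \sum_i b i *~ chi i x + tau x &
      forall i j, chi i (b j) = (i == j)%:R].
Proof.
have ex : exists n, `[< exists g : 'I_n -> A, gen_mod_torsion g >].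
  have [n [g gP]] := fgA; exists n; apply/asboolP; exists g => x.
  by have [c xc] := gP x; exists c; rewrite [in X in X - _]xc subrr rpred0.
case: (ex_minnP ex) => k /asboolP [b bP] kmin.
have indep c := @gen_mod_torsion_indep A k b c
  (fun m h hP => kmin m (asboolT (ex_intro _ h hP))) bP.
have [c cP] := choice bP.
have coord_eq x d : x - \sum_i b i *~ d i \in @torsion A -> forall i, c x i = d i.
  move=> xd i; apply/eqP; rewrite -subr_eq0; apply/eqP.
  apply: (indep (fun i => c x i - d i)).
  under eq_bigr => j _ do rewrite mulrzBr.
  rewrite sumrB (_ : _ - _ = (x - \sum_i b i *~ d i) - (x - \sum_i b i *~ c x i)).
    exact: rpredB.
  by rewrite opprB [RHS]addrC addrA subrK.
have cB i : zmod_morphism (fun x => c x i).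
  move=> x y; apply: (coord_eq _ (fun i => c x i - c y i)).
  under eq_bigr => j _ do rewrite mulrzBr.
  rewrite sumrB (_ : _ - _ = (x - \sum_i b i *~ c x i) - (y - \sum_i b i *~ c y i)).
    exact: rpredB.
  by rewrite !opprD !opprK !addrA; congr (_ + _); exact: addrAC.
have tB : zmod_morphism (fun x => x - \sum_i b i *~ c x i).
  move=> x y; under eq_bigr => j _ do rewrite (cB j) mulrzBr.
  by rewrite sumrB !opprD !opprK !addrA; congr (_ + _); exact: addrAC.
exists k, b, (fun i => additive_of (cB i)), (additive_of tB); split=> [//|t tT|x|i j] /=.
- by rewrite big1 ?subr0 // => i _; rewrite -[c t i]/(additive_of (cB i) t) hom_int_torsion ?mulr0z.
- by rewrite addrC subrK.
apply: (coord_eq _ (fun i => (i == j)%:R)).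
rewrite (bigD1 j) //= eqxx mulr1z big1 ?addr0 ?subrr ?rpred0 // => l /negPf ->.
by rewrite mulr0z.
Qed.

(** The torsion subgroup is generated by the finitely many elements
    [tau (g i)], so the product of their orders kills it. *)
Lemma fg_exponent : exists2 e, (0 < e)%N & forall t, t \in @torsion A -> t *+ e = 0.
Proof.
have [k [b [chi [tau [tauT tau_id _ _]]]]] := fg_split.
have [n [g gP]] := fgA.
have /choice [o oP] : forall i, exists m, (0 < m)%N /\ tau (g i) *+ m = 0.
  by move=> i; have /torsionP [m m0 mP] := tauT (g i); exists m.
exists (\prod_i o i)%N; first by rewrite prodn_cond_gt0 // => i _; have [] := oP i.
move=> t tT.
rewrite -(tau_id t tT); have [c ->] := gP t; rewrite raddf_sum -sumrMnl big1 // => i _.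
have [_ oi] := oP i.
by rewrite raddfMz pmulrn mulrzAC -pmulrn (bigD1 i) //= mulrnA oi mul0rn mul0rz.
Qed.

Lemma fg_torsion_finite : finite_set [set x : A | x \in @torsion A].
Proof.
have [k [b [chi [tau [tauT tau_id _ _]]]]] := fg_split.
have [e e0 eP] := fg_exponent.
have [n [g gP]] := fgA.
(* Coefficients only matter modulo the exponent. *)
apply: (@sub_finite_set _ _
  [set \sum_i tau (g i) *+ (h i : 'I_e) | h in [set: {ffun 'I_n -> 'I_e}]]).
  move=> t /= tT; have [c tc] := gP t.
  have cmod i : exists m : 'I_e, tau (g i) *~ c i = tau (g i) *+ m.
    have lt_e : (`|(c i %% e)%Z| < e)%N.
      rewrite -ltz_nat gez0_abs ?modz_ge0 ?ltz_pmod //; lia.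
    exists (Ordinal lt_e) => /=; rewrite {1}(divz_eq (c i) e) mulrzDr mulrC mulrzA -pmulrn.
    by rewrite eP // mul0rz add0r pmulrn gez0_abs // modz_ge0 //; lia.
  have [m mP] := choice cmod.
  exists [ffun i => m i] => //.
  rewrite -[RHS](tau_id t tT) tc raddf_sum; apply: eq_bigr => i _; by rewrite ffunE raddfMz mP.
exact/finite_image/finite_finset.
Qed.

End FinitelyGenerated.

Lemma finite_group_torsion (A : zmodType) : finite_group A -> forall x, x \in @torsion A.
Proof.
move=> /finite_set_range [n [s sP]] x; apply/torsionP.
have /choice [idx idxP] : forall k : nat, exists i, s i = x *+ k.
  by move=> k; have [i _ ik] := sP (x *+ k) I; exists i.
apply: contrapT => xn.
(* Pigeonhole on the multiples [0, x, ..., n x] among [n] elements. *)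
have inj : injective (fun k : 'I_n.+1 => idx k).
  suff le k l : (k <= l)%N -> idx k = idx l -> (l <= k)%N.
    move=> k l kl; apply/val_inj/anti_leq/andP.
    by have /orP[le1|le1] := leq_total k l; split=> //; apply: le.
  move=> kl /(congr1 s); rewrite !idxP leqNgt => E; apply/negP => lk.
  apply: xn; exists (l - k)%N; first by rewrite subn_gt0.
  by rewrite mulrnBr // E subrr.
by have := leq_card _ inj; rewrite !card_ord ltnn.
Qed.

Lemma fg_torsion_finite_group (A : zmodType) :
  finitely_generated A -> (forall x, x \in @torsion A) -> finite_group A.
Proof.
by move=> fgA tA; apply: sub_finite_set (fg_torsion_finite fgA) => x _; exact: tA.
Qed.

Lemma finite_group_exponent (A : zmodType) : finite_group A ->
  exists2 e, (0 < e)%N & forall x : A, x *+ e = 0.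
Proof.
move=> fA; have tA := finite_group_torsion fA.
have [n [s sP]] := finite_set_range fA.
have /choice [o oP] : forall i, exists m, (0 < m)%N /\ s i *+ m = 0.
  by move=> i; have /torsionP [m m0 mP] := tA (s i); exists m.
exists (\prod_i o i)%N; first by rewrite prodn_cond_gt0 // => i _; have [] := oP i.
move=> x; have [i _ <-] := sP x I; have [_ oi] := oP i.
by rewrite (bigD1 i) //= mulrnA oi mul0rn.
Qed.

Lemma prime_order_multiple (A : zmodType) (x : A) n : (0 < n)%N -> x *+ n = 0 -> x != 0 ->
  exists p m, [/\ prime p, (p %| n)%N, x *+ m != 0 & x *+ m *+ p = 0].
Proof.
have [k] := ubnP n; elim: k n => // k IH n nk n0 xn x0.
have n1 : (1 < n)%N.
  by rewrite ltn_neqAle n0 andbT; apply: contra x0 => /eqP n1; rewrite -(mulr1n x) n1 xn.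
have pp := pdiv_prime n1; have pn := pdiv_dvd n.
have [xm|xm] := eqVneq (x *+ (n %/ pdiv n)) 0; last first.
  by exists (pdiv n), (n %/ pdiv n)%N; split; rewrite // -mulrnA divnK.
have [||q [m [qp qn qm1 qm2]]] := IH (n %/ pdiv n)%N _ _ xm x0.
- by move: nk; rewrite ltnS; apply: leq_trans; rewrite ltn_Pdiv ?prime_gt1.
- by rewrite divn_gt0 ?prime_gt0 // dvdn_leq.
by exists q, m; split=> //; apply: dvdn_trans qn (dvdn_div pn).
Qed.

(** The order of a [p]-torsion element divides [gcdn (p ^ k) e], hence the
    [p]-part of [e]. *)
Lemma p_part_exponent (A : zmodType) (x : A) p e k :
  prime p -> (0 < e)%N -> x *+ e = 0 -> x *+ (p ^ k) = 0 -> x *+ e`_p = 0.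
Proof.
move=> pp e0 xe xk; have := mulrn_gcd xk xe.
rewrite -[in gcdn _ e](partnC p e0) mulnC Gauss_gcdr; last first.
  by apply: coprimeXl; apply: pnat_coprime (part_pnat _ _); rewrite pnat_id.
have /dvdnP [q qE] := dvdn_gcdr (p ^ k) e`_p.
by move=> xg; rewrite qE mulnC mulrnA xg mul0rn.
Qed.

Lemma p_torsion_torsion (A : zmodType) p (x : A) :
  prime p -> x \in @p_torsion A p -> x \in @torsion A.
Proof.
move=> pp /p_torsionP [k xk]; apply/torsionP; exists (p ^ k)%N => //.
by rewrite expn_gt0 prime_gt0.
Qed.

Section FinitelyGenerated.
Variable A : zmodType.
Hypothesis fgA : finitely_generated A.

(** If every element were divisible by [p], an element [y] of order [p] would be
    [z *+ p ^ k] for every [k], with [z] again a [p]-torsion element; but some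
    power of [p] kills all [p]-torsion.  Hence some element is not divisible by
    [p], and a linear form detects it. *)
Lemma fg_hom_Fp p : prime p -> nonzero (p_component A p) ->
  exists (f : {additive A -> 'F_p}) a, f a != 0.
Proof.
move=> pp /nonzero_p_componentP [y y0 yp].
suff [a ap] : exists a, forall b : A, b *+ p <> a.
  by have [f fa] := hom_to_Fp pp ap; exists f, a.
apply: contrapT => H; move/eqP: y0; apply.
have {H} div a : exists b : A, b *+ p = a.
  by apply: contrapT => ab; apply: H; exists a => b ba; apply: ab; exists b.
have [e e0 eP] := fg_exponent fgA.
have [z zy] : exists z, z *+ (p ^ logn p e) = y.
  elim: (logn p e) => [|j [z zy]]; first by exists y.
  by have [b bz] := div z; exists b; rewrite expnS mulrnA bz.
have zk : z *+ (p ^ (logn p e).+1) = 0 by rewrite expnSr mulrnA zy.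
have zT : z \in @torsion A by apply: (p_torsion_torsion pp); apply/p_torsionP; eexists; exact: zk.
by rewrite -zy -p_part; exact: p_part_exponent (eP _ zT) zk.
Qed.

Lemma fg_infinite_hom_int : ~ finite_group A ->
  exists (f : {additive A -> int}) a, f a = 1.
Proof.
move=> infA; have [k [b [chi [tau [tauT tau_id tauE chib]]]]] := fg_split fgA.
case: k b chi tauE chib => [|k] b chi tauE chib.
  case: infA; apply: fg_torsion_finite_group => // x.
  by rewrite [x]tauE big_ord0 add0r.
by exists (chi ord0), (b ord0); rewrite chib eqxx.
Qed.

Lemma fg_infinite_hom_Fp p : prime p -> ~ finite_group A ->
  exists (f : {additive A -> 'F_p}) a, f a != 0.
Proof.
move=> pp /fg_infinite_hom_int [f [a fa]].
have fB : zmod_morphism (fun x => (f x)%:~R : 'F_p) by move=> x y; rewrite raddfB intrB.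
by exists (additive_of fB), a; rewrite /= fa oner_neq0.
Qed.

(** The structure theorem: [A] is isomorphic, through [chi] and [pi], to the
    product of [k] copies of [int] and of its primary components.  The
    isomorphism is given by coordinates because these are what gets regrouped
    for a product of such groups. *)
Lemma fg_structure : exists k (chi : 'I_k -> {additive A -> int})
    (pi : forall p : {p : nat | prime p}, {additive A -> p_component A (val p)}),
  [/\ forall x, (forall i, chi i x = 0) -> (forall p, pi p x = 0) -> x = 0,
      forall (c : 'I_k -> int) (y : forall p : {p : nat | prime p}, p_component A (val p)),
        exists x, (forall i, chi i x = c i) /\ (forall p, pi p x = y p) &
      (0 < k)%N -> ~ finite_group A].
Proof.
have [k [b [chi [tau [tauT tau_id tauE chib]]]]] := fg_split fgA.
have [e e0 eP] := fg_exponent fgA.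
have taub i : tau (b i) = 0.
  apply: (addrI (b i)); rewrite addr0 [RHS]tauE; congr (_ + _).
  rewrite (bigD1 i) //= chib eqxx mulr1z big1 ?addr0 // => j /negPf ji.
  by rewrite chib ji mulr0z.
(* Multiplication by [u p] is the projection of the torsion subgroup onto its
   [p]-component: by the Chinese remainder theorem [u p] can be chosen congruent
   to 1 modulo the [p]-part of the exponent and to 0 modulo the other part. *)
have /choice [u uP] : forall p : {p : nat | prime p}, exists u : nat,
    (u = 1 %[mod e`_(val p)])%N /\ (e %| u * e`_(val p))%N.
  case=> p pp /=; exists (chinese e`_p e`_p^' 1 0).
  have co := coprime_partC p e e.
  split; first exact: chinese_modl.
  rewrite -{1}(partnC p e0) mulnC dvdn_mul //.
  by have /eqP := chinese_modr co 1 0; rewrite mod0n.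
have piT p x : tau x *+ u p \in @p_torsion A (val p).
  apply/p_torsionP; exists (logn (val p) e); rewrite -p_part -mulrnA.
  by have /dvdnP [q ->] := (uP p).2; rewrite mulnC mulrnA eP // mul0rn.
have piB p : zmod_morphism
    (fun x => exist (fun z => z \in @p_torsion A (val p)) (tau x *+ u p) (piT p x)
       : p_component A (val p)).
  by move=> x y; apply: val_inj; rewrite /= raddfB mulrnBl.
have u1 p t : t \in @p_torsion A (val p) -> t *+ u p = t.
  move=> tp; have [k' tk] := (p_torsionP _ _).1 tp.
  have te : t *+ e`_(val p) = 0.
    by apply: p_part_exponent (valP p) e0 (eP _ _) tk; apply: p_torsion_torsion (valP p) tp.
  have modE n : t *+ (n %% e`_(val p)) = t *+ n.
    by rewrite [in RHS](divn_eq n e`_(val p)) mulrnDr mulnC mulrnA te mul0rn add0r.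
  by rewrite -modE (uP p).1 modE.
have u0 (p q : {p : nat | prime p}) t : p <> q -> t \in @p_torsion A (val q) -> t *+ u p = 0.
  move=> pq tq; have [l tl] := (p_torsionP _ _).1 tq.
  apply: (@mulrn_coprime _ _ (val q ^ l)%N e`_(val p)).
  - rewrite p_part coprimeXl // coprimeXr // prime_coprime ?(valP q) //.
    rewrite dvdn_prime2 ?(valP q) ?(valP p) //.
    by apply/eqP => qp; apply: pq; apply: val_inj.
  - by rewrite mulrnAC tl mul0rn.
  - rewrite -mulrnA; have /dvdnP [r ->] := (uP p).2.
    by rewrite mulnC mulrnA eP ?mul0rn // (p_torsion_torsion (valP q)).
exists k, chi, (fun p => additive_of (piB p)); split=> [x chi0 pi0|c y|].
- have xt : x = tau x by rewrite [LHS]tauE big1 ?add0r // => i _; rewrite chi0 mulr0z.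
  apply/eqP; apply: contraT => x0.
  have xe : x *+ e = 0 by rewrite xt eP.
  have [p [m [pp pe /eqP xm xmp]]] := prime_order_multiple e0 xe x0.
  case: xm; rewrite -(u1 (exist _ p pp) (x *+ m)); last by apply/p_torsionP; exists 1%N; rewrite expn1.
  have /(congr1 val) /= := pi0 (exist _ p pp); rewrite -xt => E.
  by rewrite mulrnAC E mul0rn.
- (* Components at primes above the exponent vanish, so a sum over [n <= e]
     already collects all of [y]. *)
  pose Y n : A := if pselect (prime n) is left h then val (y (exist _ n h)) else 0.
  have YE (p : {p : nat | prime p}) : Y (val p) = val (y p).
    case: p => p pp; rewrite /Y /=; case: pselect => // pp'.
    by rewrite (Prop_irrelevance pp' pp).
  have YT n : Y n \in @torsion A.
    rewrite /Y; case: pselect => [h|_]; last exact: rpred0.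
    exact: (p_torsion_torsion h (valP (y (exist _ n h)))).
  have ST : \sum_(n < e.+1) Y n \in @torsion A by rewrite rpred_sum.
  exists (\sum_i b i *~ c i + \sum_(n < e.+1) Y n); split=> [i|p].
    rewrite raddfD raddf_sum (hom_int_torsion _ ST) addr0 (bigD1 i) //= big1 => [|j ji].
      by rewrite raddfMz chib eqxx addr0 -mulrzr mul1r intz.
    by rewrite raddfMz chib eq_sym (negPf ji) mul0rz.
  apply: val_inj => /=.
  have -> : tau (\sum_i b i *~ c i + \sum_(n < e.+1) Y n) = \sum_(n < e.+1) Y n.
    rewrite raddfD (tau_id _ ST) raddf_sum big1 ?add0r // => i _.
    by rewrite raddfMz taub mul0rz.
  rewrite -YE -sumrMnl.
  have Yq (n : 'I_e.+1) : val n != val p -> Y n *+ u p = 0.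
    rewrite {1}/Y; case: pselect => [h np|]; last by rewrite mul0rn.
    pose q : {p : nat | prime p} := exist _ (n : nat) h.
    have pq : p <> q by move=> pn; rewrite pn eqxx in np.
    exact: (u0 p q _ pq (valP (y q))).
  have Yp : Y (val p) \in @p_torsion A (val p) by rewrite YE; exact: valP.
  have [pe|ep] := ltnP (val p) e.+1.
    rewrite (bigD1 (Ordinal pe)) //= big1 ?addr0; first exact: u1.
    by move=> n np; apply: Yq; apply: contra np => /eqP np; apply/eqP/val_inj.
  rewrite big1 => [|n _]; last first.
    by apply: Yq; apply/eqP => np; move: (ltn_ord n); rewrite np ltnNge ep.
  have [l Yl] := (p_torsionP _ _).1 Yp.
  apply/esym; apply: mulrn_coprime (eP _ (YT _)) Yl.
  by rewrite coprime_sym coprimeXl // prime_coprime ?(valP p) // gtnNdvd.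
- move=> k0 /finite_group_torsion /(_ (b (Ordinal k0))) /(hom_int_torsion (chi (Ordinal k0))).
  by rewrite chib eqxx.
Qed.

End FinitelyGenerated.

(** * Finiteness criteria *)

Lemma inj_surj_bijective (T U : Type) (f : T -> U) :
  injective f -> (forall y, exists x, f x = y) -> bijective f.
Proof. by move=> fi /choice [g gP]; exists g => // x; apply: fi. Qed.

(** A homomorphism vanishes as soon as it does so on the finitely many
    generators. *)
Lemma fg_pointwise_finite (A B : zmodType) (J : Type) (h : J -> {additive A -> B}) :
  finitely_generated A -> (forall a, finite_set [set j | h j a != 0]) ->
  finite_set [set j | exists a, h j a != 0].
Proof.
move=> [n [g gP]] hfin.
apply: (@sub_finite_set _ _ (\bigcup_(i in [set: 'I_n]) [set j | h j (g i) != 0])).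
  move=> j [a ja]; apply: contrapT => H; move/eqP: ja; apply.
  have [c ->] := gP a; rewrite raddf_sum big1 // => i _; rewrite raddfMz.
  suff -> : h j (g i) = 0 by rewrite mul0rz.
  by apply: contrapT => /eqP ji; apply: H; exists i.
by apply: bigcup_finite => // i _.
Qed.

(** Generation in terms of subgroups, which avoids handling coefficients when
    generators come from several groups. *)
Lemma fg_of_seq (A : zmodType) (s : seq A) :
  (forall P : set A, subgroup P -> {in s, forall g, P g} -> forall x, P x) ->
  finitely_generated A.
Proof.
move=> sP; exists (size s), (tnth (in_tuple s)).
pose lin x := exists c : 'I_(size s) -> int, x = \sum_i tnth (in_tuple s) i *~ c i.
apply: (sP lin); first split.
- by exists (fun=> 0); rewrite big1 // => i _; rewrite mulr0z.
- move=> x y [c ->] [d ->]; exists (fun i => c i - d i).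
  by rewrite -sumrB; apply: eq_bigr => i _; rewrite mulrzBr.
move=> g /(tnthP (in_tuple s)) [i ->]; exists (fun j => (j == i)%:R).
by rewrite (bigD1 i) //= eqxx big1 ?addr0 // => j /negPf ->; rewrite mulr0z.
Qed.

Lemma fg_dsum_image (I : Type) (N : I -> zmodType) (Q : zmodType)
    (f : {additive dsum N -> Q}) (X : set I) :
  (forall y, exists x, f x = y) -> finite_set X ->
  (forall i, finitely_generated (N i)) ->
  (forall i, ~ X i -> forall a : N i, f (dsingle a) = 0) ->
  finitely_generated Q.
Proof.
move=> fsurj /finite_set_range [n [e eX]] Nfg fX.
pose m i := projT1 (cid (Nfg i)).
pose g i := projT1 (cid (projT2 (cid (Nfg i)))).
have gP i : forall x : N i, exists c : 'I_(m i) -> int, x = \sum_j g i j *~ c j.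
  exact: (projT2 (cid (projT2 (cid (Nfg i))))).
apply: (@fg_of_seq _ (flatten (codom (fun k : 'I_n => codom (fun j => f (dsingle (g (e k) j))))))).
move=> P sP Pg y; have [x <-] := fsurj y.
apply: (dsum_ind (subgroup_preim f sP)) => i a /=.
have [Xi|nXi] := pselect (X i); last by rewrite fX //; exact: sP.1.
have [c ->] := gP i a; have [k _ ki] := eX i Xi.
rewrite !raddf_sum; apply: subgroup_sum => // j; rewrite !raddfMz.
apply: subgroupMz => //; apply: Pg; apply/flattenP.
exists (codom (fun j => f (dsingle (g (e k) j)))); first exact: codom_f.
case: _ / ki j {c} => j; exact: codom_f.
Qed.

Lemma finite_group_fg (A : zmodType) : finite_group A -> finitely_generated A.
Proof.
move=> /finite_set_range [n [s sP]]; exists n, s => x; have [i _ <-] := sP x I.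
exists (fun j => (j == i)%:R).
by rewrite (bigD1 i) //= eqxx big1 ?addr0 // => j /negPf ->; rewrite mulr0z.
Qed.

Lemma finite_group_inj (A B : zmodType) (f : A -> B) :
  injective f -> finite_group B -> finite_group A.
Proof.
move=> fi fB; have := @finite_preimage _ _ [set: B] f.
by rewrite preimage_setT; apply => // x y _ _; exact: fi.
Qed.

Lemma finite_gprod (I : Type) (N : I -> zmodType) (X : set I) :
  finite_set X -> (forall i, finite_group (N i)) ->
  (forall i, ~ X i -> forall a : N i, a = 0) -> finite_group (gprod N).
Proof.
move=> Xfin Nfin NX.
have valB : zmod_morphism (fun x : dsum N => val x) by [].
have surj (y : gprod N) : exists x, additive_of valB x = y.
  suff ys : y \in @fin_supp I N by exists (to_dsum ys).
  apply/asboolP; apply: sub_finite_set Xfin => i /= /eqP yi.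
  by apply: contrapT => /NX /(_ (y i)).
apply: fg_torsion_finite_group.
  apply: (fg_dsum_image surj Xfin) => [i|i Xi a]; first exact: finite_group_fg.
  by rewrite (NX _ Xi a) !raddf0.
move=> y; have [x <-] := surj y.
apply: (dsum_ind (subgroup_preim (additive_of valB) (torsion_subgroup (gprod N)))) => i a /=.
have /torsionP [n n0 an] := finite_group_torsion (Nfin i) a.
by apply/torsionP; exists n => //; rewrite -raddfMn an raddf0.
Qed.

(** A uniform exponent is needed for the divisibility arguments; the definition
    of a [p]-group only gives one for each element. *)
Lemma p_group_exponent (A : zmodType) p : prime p -> finite_group A -> p_group A p ->
  exists k, forall x : A, x *+ (p ^ k) = 0.
Proof.
move=> pp /finite_group_exponent [e e0 eP] pA; exists (logn p e) => x.
by have /p_torsionP [k xk] := pA x; rewrite -p_part; exact: p_part_exponent xk.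
Qed.

Lemma coprime_divisible (A : zmodType) (x : A) m n :
  (0 < m)%N -> coprime m n -> x *+ m = 0 -> exists y, x = y *+ n.
Proof.
move=> m0 /eqP mn xm; have [a _ /dvdnP [q qE]] := Bezoutl n m0.
exists (- (x *+ a)); apply/eqP; rewrite mulNrn -subr_eq0 opprK; apply/eqP.
by rewrite -[X in X + _]mulr1n -mulrnA -mulrnDr -mn qE mulnC mulrnA xm mul0rn.
Qed.

(** * Products of finite primary groups *)

Section PrimaryProduct.
Variable Mp : {p : nat | prime p} -> zmodType.
Hypothesis Mfin : forall p, finite_group (Mp p).
Hypothesis Mpg : forall p, p_group (Mp p) (val p).

(** Multiplication by [p] is invertible on every factor other than the one at
    [p]. *)
Lemma primary_product_divisible p (x : gprod Mp) k : x p = 0 ->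
  exists y, x = y *+ (val p ^ k).
Proof.
move=> xp.
have ex q : exists y : Mp q, x q = y *+ (val p ^ k).
  have [<-|pq] := pselect (p = q); first by exists 0; rewrite mul0rn.
  have /p_torsionP [l xl] := Mpg (x q).
  apply: (@coprime_divisible _ _ (val q ^ l)) => //.
    by rewrite expn_gt0 prime_gt0 ?(valP q).
  apply: coprimeXl; apply: coprimeXr; rewrite prime_coprime ?(valP q) //.
  rewrite dvdn_prime2 ?(valP q) ?(valP p) //.
  by apply/eqP => qp; apply: pq; apply: val_inj.
exists (fun q => projT1 (cid (ex q))); apply: functional_extensionality_dep => q.
by rewrite -[RHS]/(gproj Mp q _) raddfMn /=; case: cid.
Qed.

(** For every prime [p], up to the torsion coordinate at [p] the element [x] is
    divisible by [p], so [p] divides [f x]; a prime exceeding the absolute value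
    of [f x] forces [f x = 0]. *)
Lemma primary_product_hom_int (f : {additive gprod Mp -> int}) x : f x = 0.
Proof.
have [p xp pp] := prime_above `|f x|.
pose q : {p : nat | prime p} := exist _ p pp.
have fs : f (gsingle (x q)) = 0.
  have /torsionP [n n0 xn] := finite_group_torsion (Mfin q) (x q).
  by apply: hom_int_torsion; apply/torsionP; exists n => //; rewrite -raddfMn xn raddf0.
have x0 : (x - gsingle (x q)) q = 0 by rewrite gprodBE gsingleE subrr.
have [y yE] := primary_product_divisible 1 x0.
have fE : f x = f y * p%:Z.
  by rewrite -[in LHS](gprod_split x q) raddfD fs add0r yE raddfMn expn1 -mulr_natr natz.
move: xp; rewrite fE abszM ltnNge absz_nat.
have [->|fy] := eqVneq (f y) 0; first by rewrite mul0r.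
by rewrite leq_pmull ?absz_gt0.
Qed.

(** The complement of the factor at [p] is divisible by every power of [p],
    while some power of [p] kills the target. *)
Lemma primary_product_hom_component p (f : {additive gprod Mp -> Mp p}) x :
  f x = f (gsingle (x p)).
Proof.
rewrite -[in LHS](gprod_split x p) raddfD.
have [k kP] := p_group_exponent (valP p) (Mfin p) (@Mpg p).
have x0 : (x - gsingle (x p)) p = 0 by rewrite gprodBE gsingleE subrr.
by have [y ->] := primary_product_divisible k x0; rewrite raddfMn kP addr0.
Qed.

(** By the preceding lemma [h j] acts on each factor separately, and for a fixed
    [p] only finitely many [h j] act nontrivially on the factor at [p], this
    factor being finite.  Call [p] new when some [h j] acts on it that acts on
    no factor at a smaller prime.  Picking for each new [p] such a [j] and a
    coordinate not killed by [h j] yields one element [x] that is not killed by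
    any of the chosen [h j]; these are distinct, so there are finitely many new
    primes, and every nonzero [h j] acts on the factor at some new prime. *)
Lemma primary_product_pointwise_finite (J : Type) (h : J -> {additive gprod Mp -> gprod Mp}) :
  (forall x, finite_set [set j | h j x != 0]) ->
  finite_set [set j | exists x, h j x != 0].
Proof.
move=> hfin.
pose Jp p := [set j | exists a : Mp p, h j (gsingle a) p != 0].
have hE j x p : h j x p = h j (gsingle (x p)) p.
  exact: (primary_product_hom_component (gproj Mp p \o h j) x).
have Jpfin p : finite_set (Jp p).
  apply: (@fg_pointwise_finite _ _ _ (fun j => (gproj Mp p \o h j) \o @gsingle _ Mp p)).
    exact: finite_group_fg.
  move=> a; apply: sub_finite_set (hfin (gsingle a)) => j /=.
  by apply: contra => /eqP ->.
pose new p := exists j, Jp p j /\ forall q, (val q < val p)%N -> ~ Jp q j.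
have ex p : exists ja : option J * Mp p, new p -> exists j,
    [/\ ja.1 = Some j, h j (gsingle ja.2) p != 0 &
        forall q : {p | prime p}, (val q < val p)%N -> ~ Jp q j].
  have [[j [[a ja] jq]]|np] := pselect (new p); last by exists (None, 0).
  by exists (Some j, a) => _; exists j.
pose b p := (projT1 (cid (ex p))).1.
pose x : gprod Mp := fun p => (projT1 (cid (ex p))).2.
have bP p : new p -> exists j, [/\ b p = Some j, h j x p != 0 &
    forall q : {p | prime p}, (val q < val p)%N -> ~ Jp q j].
  move=> np; have [j [bj jp jq]] := projT2 (cid (ex p)) np.
  by exists j; split=> //; rewrite hE.
(* Distinct new primes have distinct chosen indices: the index chosen for the
   larger one does not act on the factor at the smaller one. *)
have /choice [g gP] : forall j, exists p, forall q, new q -> b q = Some j -> q = p.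
  move=> j; have [[p [np bp]]|nj] := pselect (exists p, new p /\ b p = Some j).
    exists p => q nq bq.
    have [j1 [bj1 /= jp jlt]] := bP p np; move: bj1; rewrite bp => -[jj1]; subst j1.
    have [j2 [bj2 /= jq jlt']] := bP q nq; move: bj2; rewrite bq => -[jj2]; subst j2.
    have jJ r : h j x r != 0 -> Jp r j by rewrite hE; exists (x r).
    apply: val_inj; have [lt|lt|//] := ltngtP (val q) (val p).
      by case: (jlt q lt); exact: jJ.
    by case: (jlt' p lt); exact: jJ.
  by exists (exist _ 2 isT) => q nq bq; case: nj; exists q.
have newfin : finite_set new.
  apply: (@sub_finite_set _ _ [set g j | j in [set j | h j x != 0]]); last exact: finite_image.
  move=> p np; have [j [bj jp _]] := bP p np.
  exists j; last by rewrite -(gP j p np bj).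
  by apply: contra jp => /eqP ->.
apply: (@sub_finite_set _ _ (\bigcup_(p in new) Jp p)); last exact: bigcup_finite.
move=> j [z jz].
have [p jp] : exists p, Jp p j.
  apply: contrapT => nj; move/eqP: jz; apply; apply: functional_extensionality_dep => p.
  rewrite hE; apply/eqP; apply: contraT => pz; case: nj; by exists p, (z p).
have exn : exists n, `[< exists p, val p = n /\ Jp p j >].
  by exists (val p); apply/asboolP; exists p.
case: (ex_minnP exn) => n /asboolP [q [qn jq]] nmin.
exists q => //; exists j; split=> // r rq jr.
have : (n <= val r)%N by apply: nmin; apply/asboolP; exists r.
by rewrite -qn leqNgt rq.
Qed.

End PrimaryProduct.

Lemma hom_free_abelian_eq0 (A F : zmodType) (f : {additive A -> F}) :
  free_abelian F -> (forall (g : {additive A -> int}) x, g x = 0) -> forall x, f x = 0.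
Proof.
move=> [J [u /bij_inj uinj]] A0 x; apply: uinj; rewrite raddf0.
apply: val_inj; apply: functional_extensionality_dep => j /=.
exact: (A0 (dproj (fun=> int) j \o u \o f) x).
Qed.

Section Pair.
Variables A B : zmodType.

Fact pair_inl_zmod_morphism : zmod_morphism (fun x : A => (x, 0 : B)).
Proof. by move=> x y; congr pair; rewrite subr0. Qed.

Fact pair_inr_zmod_morphism : zmod_morphism (fun y : B => (0 : A, y)).
Proof. by move=> x y; congr pair; rewrite subr0. Qed.

Lemma pair_sum (z : A * B) : z = (z.1, 0) + (0, z.2).
Proof. by case: z => x y; congr pair; rewrite /= ?addr0 ?add0r. Qed.

End Pair.

Lemma self_small_isomorphic (A B : zmodType) :
  isomorphic A B -> self_small B -> self_small A.
Proof.
move=> [u [v uK vK]] /small_iff_pointwise_finite sB; apply/small_iff_pointwise_finite => J h hfin.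
have vB : zmod_morphism v by move=> x y; apply: (can_inj uK); rewrite raddfB !vK.
have uE a : (u a != 0) = (a != 0).
  by rewrite -(inj_eq (can_inj uK)) raddf0.
apply: (sub_finite_set _ (sB J (fun j => u \o h j \o additive_of vB) _)) => [j [a ja]|b].
  by exists (u a); rewrite /= uK uE.
by apply: sub_finite_set (hfin (v b)) => j /=; rewrite uE.
Qed.

(** The free part is finitely generated, hence harmless; the primary part maps
    trivially to the free part, which leaves its endomorphisms. *)
Lemma self_small_free_primary (F : zmodType) (Mp : {p : nat | prime p} -> zmodType) :
  finitely_generated F -> free_abelian F ->
  (forall p, finite_group (Mp p)) -> (forall p, p_group (Mp p) (val p)) ->
  self_small (F * gprod Mp)%type.
Proof.
move=> fgF freeF Mfin Mpg; apply/small_iff_pointwise_finite => J h hfin.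
pose inl := additive_of (@pair_inl_zmod_morphism F (gprod Mp)).
pose inr := additive_of (@pair_inr_zmod_morphism F (gprod Mp)).
have h1 j y : (h j (inr y)).1 = 0.
  apply: (hom_free_abelian_eq0 (fst \o h j \o inr) freeF) => g x.
  exact: primary_product_hom_int.
apply: (@sub_finite_set _ _ ([set j | exists x, (h j \o inl) x != 0] `|`
    [set j | exists y, (snd \o h j \o inr) y != 0])).
  move=> j [z jz]; apply: contrapT => /not_orP [H1 H2]; move/eqP: jz; apply.
  rewrite (pair_sum z) raddfD.
  have -> : h j (z.1, 0) = 0.
    by apply/eqP; apply: contraT => zl; case: H1; exists z.1.
  rewrite add0r -[h j _]/(h j (inr z.2)).
  have : (h j (inr z.2)).2 = 0.
    by apply/eqP; apply: contraT => zr; case: H2; exists z.2.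
  by move: (h1 j z.2); case: (h j (inr z.2)) => /= a b -> ->.
rewrite finite_setU; split.
  by apply: fg_pointwise_finite => // a; apply: sub_finite_set (hfin (inl a)).
apply: primary_product_pointwise_finite => // y.
by apply: sub_finite_set (hfin (inr y)) => j /=; apply: contra => /eqP ->.
Qed.

(** * The finiteness condition *)

Definition no_hom (A B : zmodType) : Prop := forall (f : {additive A -> B}) a, f a = 0.

Lemma fg_p_component_finite (A : zmodType) p :
  finitely_generated A -> prime p -> finite_group (p_component A p).
Proof.
move=> fgA pp; have := @finite_preimage _ _ [set x : A | x \in @torsion A]
  (fun x : p_component A p => val x).
have -> : (fun x : p_component A p => val x) @^-1` [set x | x \in @torsion A] = setT.
  by apply/seteqP; split=> // x _ /=; exact: p_torsion_torsion (valP x).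
by apply; [move=> x y _ _; exact: val_inj|exact: fg_torsion_finite].
Qed.

Lemma nonzero_torsion_part_prime (A : zmodType) :
  nonzero (torsion_part A) -> exists p, prime p /\ nonzero (p_component A p).
Proof.
move=> [[x xt] /eqP x0].
have {x0} x0 : x != 0 by apply/eqP => xx; apply: x0; apply: val_inj.
have /torsionP [n n0 xn] := xt.
have [p [m [pp _ xm xmp]]] := prime_order_multiple n0 xn x0.
by exists p; split=> //; apply/nonzero_p_componentP; exists (x *+ m).
Qed.

Lemma nonzero_hom_via_Fp (A B : zmodType) p : prime p ->
  (exists (f : {additive A -> 'F_p}) a, f a != 0) -> nonzero (p_component B p) ->
  nonzero (hom_group A B).
Proof.
move=> pp [f [a fa]] /nonzero_p_componentP [y y0 yp].
have [g gP] := hom_from_Fp pp y0 yp.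
by apply/nonzero_hom_groupP; exists (g \o f), a; exact: gP.
Qed.

(** A prime [p] dividing the order of [f a] divides the order of [a]; the
    [p]-part of a suitable multiple of [a] is still not killed by [f]. *)
Lemma hom_torsion_common_prime (A B : zmodType) (f : {additive A -> B}) a :
  a \in @torsion A -> f a != 0 ->
  exists p, [/\ prime p, nonzero (p_component A p) & nonzero (p_component B p)].
Proof.
move=> /torsionP [n n0 an] fa.
have fan : f a *+ n = 0 by rewrite -raddfMn an raddf0.
have [p [m [pp pn fam famp]]] := prime_order_multiple n0 fan fa.
exists p; split=> //; last by apply/nonzero_p_componentP; exists (f a *+ m).
have ct : a *+ m *+ n`_p^' \in @p_torsion A p.
  apply/p_torsionP; exists (logn p n).
  by rewrite -p_part -mulrnA [(n`__ * _)%N]mulnC partnC // mulrnAC an mul0rn.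
exists (to_p_component ct); apply: contra fam => /eqP /(congr1 (fun c => f (val c))) /=.
rewrite raddf0 !raddfMn => fc; apply/eqP; apply: mulrn_coprime famp fc.
by rewrite prime_coprime // -p'natE // part_pnat.
Qed.

Lemma no_hom_finite_int (A : zmodType) : finite_group A -> no_hom A int.
Proof. by move=> fA f a; apply: hom_int_torsion; exact: finite_group_torsion. Qed.

Lemma no_hom_finite_p (A B : zmodType) p : prime p -> finite_group A ->
  ~ nonzero (p_component A p) -> no_hom A (p_component B p).
Proof.
move=> pp fA Ap f a; apply/eqP; apply: contraT => fa.
have [q [qp Aq /nonzero_p_componentP [y y0 yq]]] :=
  hom_torsion_common_prime (finite_group_torsion fA a) fa.
have /p_torsionP [k yk] := valP y.
have [pq|pq] := eqVneq p q; first by case: Ap; rewrite pq.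
move/eqP: y0; case; apply: val_inj; apply: (@mulrn_coprime _ _ _ q) yk _.
  by apply: coprimeXl; rewrite prime_coprime // dvdn_prime2.
by rewrite -raddfMn yq raddf0.
Qed.

Section TorsionQuotient.
Variable A : zmodType.

(** The typed projection, so that the group structure inferred is the one of
    [torsion_quotient A]. *)
Definition to_torsion_quotient (x : A) : torsion_quotient A :=
  (\pi_(Quotient.quot (@torsion A)) x)%qT.

Fact to_torsion_quotient_zmod_morphism : zmod_morphism to_torsion_quotient.
Proof. by move=> x y; exact: raddfB. Qed.

HB.instance Definition _ := GRing.isZmodMorphism.Build A (torsion_quotient A)
  to_torsion_quotient to_torsion_quotient_zmod_morphism.

Lemma to_torsion_quotient_eq0 x : to_torsion_quotient x = 0 <-> x \in @torsion A.
Proof.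
rewrite -(raddf0 to_torsion_quotient) -[x in x \in _]subr0.
by rewrite Quotient.idealrBE; split=> /eqP.
Qed.

Lemma to_torsion_quotient_surj y : exists x, to_torsion_quotient x = y.
Proof. by exists (repr y)%qT; exact: reprK. Qed.

End TorsionQuotient.

Definition finitely_many_infinite (I : Type) (N : I -> zmodType) : Prop :=
  finite_set [set i | ~ finite_group (N i)].

Definition finitely_many_p_torsion (I : Type) (N : I -> zmodType) : Prop :=
  forall p, prime p -> finite_set [set i | nonzero (p_component (N i) p)].

Section Family.
Variables (I : Type) (N : I -> zmodType).
Hypothesis N_fg : forall i, finitely_generated (N i).

(** The forms [phi i] define a map on the direct sum with values in finitely
    supported vectors.  Its extension [r] to the product still has such values,
    so following the coordinates of [r] by an embedding of the prime field into
    [gprod N] gives a pointwise finite family of endomorphisms, whose [i]-th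
    member is nonzero whenever [phi i] is. *)
Lemma self_small_gprod_finite_Fp p : prime p -> nonzero (p_component (gprod N) p) ->
  self_small (gprod N) -> finite_set [set i | exists (f : {additive N i -> 'F_p}) a, f a != 0].
Proof.
move=> pp /nonzero_p_componentP [y y0 yp] /small_iff_pointwise_finite sM.
have exphi i : exists f : {additive N i -> 'F_p},
    (exists (g : {additive N i -> 'F_p}) a, g a != 0) -> exists a, f a != 0.
  have [[f [a fa]]|nf] := pselect (exists (g : {additive N i -> 'F_p}) a, g a != 0).
    by exists f => _; exists a.
  by exists \0.
pose phi i := projT1 (cid (exphi i)).
have valB : zmod_morphism (fun x : dsum N => val x) by [].
have fB : zmod_morphism (fun s : dsum N => (fun i => phi i (val s i)) : gprod (fun _ : I => 'F_p)).
  by move=> s t; apply: functional_extensionality_dep => i; rewrite gprodBE -raddfB.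
have [|r [rf rrange]] := @hom_extension p _ _ _ (additive_of valB) (additive_of fB) pp.
  move=> s a /= sa; apply: functional_extensionality_dep => i.
  rewrite sa -[(a *+ p) i]/(gproj N i (a *+ p)) !raddfMn /=.
  by rewrite mulrn_pchar // pchar_Fp.
have [e eP] := hom_from_Fp pp y0 yp.
apply: (sub_finite_set _ (sM I (fun i => e \o gproj _ i \o r) _)) => [i fi|x].
  have [a ai] := projT2 (cid (exphi i)) fi.
  exists (gsingle a); apply: eP => /=.
  by have /(congr1 (gproj _ i)) /= := rf (dsingle a); rewrite /= gsingleE => ->.
have [s rs] := rrange x.
have /asboolP := valP s; apply: sub_finite_set => i /=; rewrite rs /=.
by apply: contra => /eqP ->; rewrite !raddf0.
Qed.

Lemma nonzero_p_component_gprod i p :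
  nonzero (p_component (N i) p) -> nonzero (p_component (gprod N) p).
Proof.
move=> /nonzero_p_componentP [y y0 yp]; apply/nonzero_p_componentP; exists (gsingle y).
  by apply: contra y0 => /eqP /(congr1 (gproj N i)) /=; rewrite gsingleE => ->.
by rewrite -raddfMn yp raddf0.
Qed.

Lemma nonzero_p_component_dsum i p :
  nonzero (p_component (N i) p) -> nonzero (p_component (dsum N) p).
Proof.
move=> /nonzero_p_componentP [y y0 yp]; apply/nonzero_p_componentP; exists (dsingle y).
  by apply: contra y0 => /eqP /(congr1 (dproj N i)) /=; rewrite gsingleE => ->.
by rewrite -raddfMn yp raddf0.
Qed.

(** The preceding lemma applies to a prime only when the product has torsion at
    that prime.  One such prime exists by hypothesis and bounds the number of
    infinite members; for any other prime either it applies, or no member has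
    torsion there. *)
Lemma self_small_gprod_finiteness : (exists i, nonzero (torsion_part (N i))) ->
  self_small (gprod N) -> finitely_many_infinite N /\ finitely_many_p_torsion N.
Proof.
move=> [i0 /nonzero_torsion_part_prime [p0 [p0p i0p]]] sM; split=> [|p pp].
  have := self_small_gprod_finite_Fp p0p (nonzero_p_component_gprod i0p) sM.
  by apply: sub_finite_set => i; exact: fg_infinite_hom_Fp.
have [[i ip]|np] := pselect (exists i, nonzero (p_component (N i) p)).
  have := self_small_gprod_finite_Fp pp (nonzero_p_component_gprod ip) sM.
  by apply: sub_finite_set => j; exact: fg_hom_Fp.
by apply: (@sub_finite_set _ _ set0) => // i ip; case: np; exists i.
Qed.

Lemma small_dsum (B : zmodType) (X : set I) : finite_set X ->
  (forall i, ~ X i -> no_hom (N i) B) -> small (dsum N) B.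
Proof.
move=> Xfin NX; apply/small_iff_pointwise_finite => J h hfin.
apply: (@sub_finite_set _ _
   (\bigcup_(i in X) [set j | exists a : N i, h j (dsingle a) != 0])).
  move=> j [x jx]; apply: contrapT => nj; move/eqP: jx; apply.
  have s0 : subgroup [set 0 : B] by split=> // a b /= -> ->; rewrite subr0.
  apply: (dsum_ind (subgroup_preim (h j) s0)) => i a /=.
  have [Xi|nXi] := pselect (X i); last exact: (NX i nXi (h j \o @dsingle I N i)).
  by apply/eqP; apply: contraT => ja; case: nj; exists i => //; exists a.
apply: bigcup_finite => // i _.
by apply: (@fg_pointwise_finite _ _ _ (fun j => h j \o @dsingle I N i)) => // a; exact: hfin.
Qed.

Lemma finiteness_small_dsum : finitely_many_infinite N -> finitely_many_p_torsion N ->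
  small (dsum N) int /\ forall p, prime p -> small (dsum N) (p_component (dsum N) p).
Proof.
move=> inf ptor; split=> [|p pp].
  apply: (small_dsum inf) => i /contrapT; exact: no_hom_finite_int.
apply: (@small_dsum _ ([set i | ~ finite_group (N i)] `|` [set i | nonzero (p_component (N i) p)])).
  by rewrite finite_setU; split=> //; exact: ptor.
by move=> i /not_orP [/contrapT fi np]; exact: no_hom_finite_p.
Qed.

(** Nonzero maps [N i -> B] composed with the coordinate projections form a
    pointwise finite family, elements of the direct sum having finite
    support. *)
Lemma small_dsum_finitely_many_hom (B : zmodType) : small (dsum N) B ->
  finite_set [set i | nonzero (hom_group (N i) B)].
Proof.
move=> /small_iff_pointwise_finite sS.
have exf i : exists f : {additive N i -> B}, nonzero (hom_group (N i) B) -> exists a, f a != 0.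
  have [/nonzero_hom_groupP [f [a fa]]|nf] := pselect (nonzero (hom_group (N i) B)).
    by exists f => _; exists a.
  by exists \0.
pose f i := projT1 (cid (exf i)).
apply: (sub_finite_set _ (sS I (fun i => f i \o dproj N i) _)) => [i fi|x].
  have [a ai] := projT2 (cid (exf i)) fi.
  by exists (dsingle a); rewrite /= gsingleE.
have /asboolP := valP x; apply: sub_finite_set => i /=.
by apply: contra => /eqP ->; rewrite raddf0.
Qed.

Lemma small_dsum_finiteness : small (dsum N) int ->
  (forall p, prime p -> small (dsum N) (p_component (dsum N) p)) ->
  finitely_many_infinite N /\ finitely_many_p_torsion N.
Proof.
move=> sZ sp; split=> [|p pp].
  apply: sub_finite_set (small_dsum_finitely_many_hom sZ) => i /(fg_infinite_hom_int (N_fg i)) [f [a fa]].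
  by apply/nonzero_hom_groupP; exists f, a; rewrite fa.
apply: sub_finite_set (small_dsum_finitely_many_hom (sp p pp)) => i ip /=.
apply: (nonzero_hom_via_Fp pp (fg_hom_Fp (N_fg i) pp ip)).
have /nonzero_p_componentP [y y0 yp] := nonzero_p_component_dsum ip.
have yt : y \in @p_torsion (dsum N) p by apply/p_torsionP; exists 1%N; rewrite expn1.
apply/nonzero_p_componentP; exists (to_p_component yt).
  by apply: contra y0 => /eqP /(congr1 val) /= ->.
by apply: val_inj; rewrite raddfMn.
Qed.

Lemma finite_gprod_p_component p : prime p -> finitely_many_p_torsion N ->
  finite_group (gprod (fun i => p_component (N i) p)).
Proof.
move=> pp ptor; apply: (finite_gprod (ptor p pp)) => [i|i np a].
  exact: fg_p_component_finite.
by apply/eqP; apply: contraT => a0; case: np; exists a.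
Qed.

Lemma finiteness_torsion_quotient : finitely_many_infinite N -> finitely_many_p_torsion N ->
  (forall p, prime p -> finite_group (p_component (dsum N) p)) /\
  finitely_generated (torsion_quotient (dsum N)).
Proof.
move=> inf ptor; split=> [p pp|].
  have xp (x : p_component (dsum N) p) i : val (val x) i \in @p_torsion (N i) p.
    have /p_torsionP [k xk] := valP x; apply/p_torsionP; exists k.
    by have /(congr1 (dproj N i)) := xk; rewrite raddfMn raddf0.
  apply: (finite_group_inj (f := fun x => (fun i => to_p_component (xp x i))
    : gprod (fun i => p_component (N i) p))); last exact: finite_gprod_p_component.
  move=> x y xy; apply: val_inj; apply: val_inj; apply: functional_extensionality_dep => i.
  exact: (congr1 (fun z : gprod (fun i => p_component (N i) p) => val (z i)) xy).
apply: (fg_dsum_image (@to_torsion_quotient_surj (dsum N)) inf N_fg) => i /contrapT fi a.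
apply/to_torsion_quotient_eq0.
have /torsionP [n n0 an] := finite_group_torsion fi a.
by apply/torsionP; exists n => //; rewrite -raddfMn an raddf0.
Qed.

(** Lifts of finitely many generators of the quotient have finite support
    altogether, and a member outside of this support is a torsion group. *)
Lemma torsion_quotient_finiteness :
  (forall p, prime p -> finite_group (p_component (dsum N) p)) ->
  finitely_generated (torsion_quotient (dsum N)) ->
  finitely_many_infinite N /\ finitely_many_p_torsion N.
Proof.
move=> pfin [n [g gP]]; split=> [|p pp].
  have [s sP] := choice (fun k => to_torsion_quotient_surj (g k)).
  apply: (@sub_finite_set _ _ (\bigcup_(k in [set: 'I_n]) [set i | val (s k) i != 0])).
    move=> i; apply: contra_notP => nsi; apply: fg_torsion_finite_group => // a.
    have [c aE] := gP (to_torsion_quotient (dsingle a)).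
    have /torsionP [m m0 am] : dsingle a - \sum_k s k *~ c k \in @torsion (dsum N).
      apply/to_torsion_quotient_eq0; rewrite raddfB /= aE raddf_sum.
      by rewrite -sumrB big1 // => k _; rewrite raddfMz /= sP subrr.
    apply/torsionP; exists m => //.
    have /(congr1 (dproj N i)) := am; rewrite raddfMn raddfB raddf_sum raddf0.
    rewrite big1 ?subr0 ?dsingleE // => k _; rewrite raddfMz.
    suff -> : dproj N i (s k) = 0 by rewrite mul0rz.
    by apply/eqP; apply: contraT => ski; case: nsi; exists k.
  by apply: bigcup_finite => // k _; have /asboolP := valP (s k).
apply: (@sub_finite_set _ _
    (\bigcup_(x in [set: p_component (dsum N) p]) [set i | val (val x) i != 0])).
  move=> i /nonzero_p_componentP [y y0 yp].
  have yt : dsingle y \in @p_torsion (dsum N) p.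
    by apply/p_torsionP; exists 1%N; rewrite expn1 -raddfMn yp raddf0.
  by exists (to_p_component yt); rewrite //= gsingleE.
by apply: (bigcup_finite (pfin p pp)) => x _; have /asboolP := valP (val x).
Qed.

(** A finite [N j] with a nonzero map to [N i] shares with it a torsion prime,
    which divides the exponent of the torsion of [N i]; there are finitely many
    such primes. *)
Lemma finiteness_hom_to : finitely_many_infinite N -> finitely_many_p_torsion N ->
  forall i, finite_set [set j | nonzero (hom_group (N j) (N i))].
Proof.
move=> inf ptor i; have [e e0 eP] := fg_exponent (N_fg i).
apply: (@sub_finite_set _ _ ([set j | ~ finite_group (N j)] `|`
   (\bigcup_(p in [set` primes e]) [set j | nonzero (p_component (N j) p)]))).
  move=> j /nonzero_hom_groupP [f [a fa]].
  have [fj|] := pselect (finite_group (N j)); [right|by left].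
  have [p [pp jp /nonzero_p_componentP [y y0 yp]]] :=
    hom_torsion_common_prime (finite_group_torsion fj a) fa.
  exists p => //=; rewrite mem_primes pp e0 /=; apply: contraT => pe.
  move/eqP: y0; case; apply: (@mulrn_coprime _ y p e _ yp); first by rewrite prime_coprime.
  by apply: eP; apply/torsionP; exists p; rewrite ?prime_gt0.
rewrite finite_setU; split=> //; apply: bigcup_finite; first exact: finite_seq.
by move=> p /=; rewrite mem_primes => /andP [pp _]; exact: ptor.
Qed.

(** Infinite members map nontrivially to every member with torsion.  For a finite
    source, sharing a torsion prime allows a nonzero map to be reversed. *)
Lemma hom_to_finiteness : (exists i, nonzero (torsion_part (N i))) ->
  (forall i, finite_set [set j | nonzero (hom_group (N j) (N i))]) ->
  finitely_many_infinite N /\ forall i, finite_group (N i) ->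
    finite_set [set j | nonzero (hom_group (N i) (N j))].
Proof.
move=> [i0 /nonzero_torsion_part_prime [p [pp i0p]]] H; split=> [|i fi].
  apply: sub_finite_set (H i0) => j infj.
  exact: nonzero_hom_via_Fp pp (fg_infinite_hom_Fp (N_fg j) pp infj) i0p.
apply: sub_finite_set (H i) => j /nonzero_hom_groupP [f [a fa]] /=.
have [p' [p'p ip jp]] := hom_torsion_common_prime (finite_group_torsion fi a) fa.
exact: nonzero_hom_via_Fp p'p (fg_hom_Fp (N_fg j) p'p jp) ip.
Qed.

(** If some finite member has [p]-torsion, it maps nontrivially to every other
    such member; otherwise only infinite members have [p]-torsion. *)
Lemma hom_from_finiteness : finitely_many_infinite N ->
  (forall i, finite_group (N i) -> finite_set [set j | nonzero (hom_group (N i) (N j))]) ->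
  finitely_many_p_torsion N.
Proof.
move=> inf H p pp.
have [[i [fi ip]]|ni] :=
    pselect (exists i, finite_group (N i) /\ nonzero (p_component (N i) p)).
  apply: sub_finite_set (H i fi) => j jp.
  exact: nonzero_hom_via_Fp pp (fg_hom_Fp (N_fg i) pp ip) jp.
by apply: sub_finite_set inf => j jp fj; apply: ni; exists j.
Qed.
End Family.

(** The free coordinates of all members together are finitely many and make up
    [F]; the primary components at [p] of all members make up [Mp p]. *)
Lemma finiteness_decomposition (I : Type) (N : I -> zmodType) :
  (forall i, finitely_generated (N i)) ->
  finitely_many_infinite N -> finitely_many_p_torsion N ->
  exists (F : zmodType) (Mp : {p : nat | prime p} -> zmodType),
    [/\ finitely_generated F, free_abelian F,
        forall p, finite_group (Mp p),
        forall p, p_group (Mp p) (val p)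
      & isomorphic (gprod N) (F * gprod Mp)%type].
Proof.
move=> N_fg inf ptor.
(* The choice of a coordinate system on every [N i]. *)
pose st i := cid (fg_structure (N_fg i)).
pose k i := projT1 (st i).
pose st2 i := cid (projT2 (st i)).
pose chi i : 'I_(k i) -> {additive N i -> int} := projT1 (st2 i).
pose st3 i := cid (projT2 (st2 i)).
pose pi i : forall p : {p : nat | prime p}, {additive N i -> p_component (N i) (val p)} :=
  projT1 (st3 i).
have Pinj i x : (forall j, chi i j x = 0) -> (forall p, pi i p x = 0) -> x = 0.
  by have [H _ _] := projT2 (st3 i); exact: H.
have Psurj i : forall (c : 'I_(k i) -> int)
    (y : forall p : {p : nat | prime p}, p_component (N i) (val p)),
    exists x, (forall j, chi i j x = c j) /\ (forall p, pi i p x = y p).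
  by have [_ H _] := projT2 (st3 i); exact: H.
have Pk i : (0 < k i)%N -> ~ finite_group (N i).
  by have [_ _ H] := projT2 (st3 i); exact: H.
pose J := {i : I & 'I_(k i)}.
have Jfin : finite_set [set: J].
  apply: (@sub_finite_set _ _ (\bigcup_(i in [set i | ~ finite_group (N i)])
      [set existT (fun i => 'I_(k i)) i j | j in [set: 'I_(k i)]])).
    move=> [i j] _; exists i; last by exists j.
    by apply: Pk; apply: leq_ltn_trans (ltn_ord j).
  by apply: bigcup_finite => // i _; apply: finite_image; exact: finite_finset.
pose F : zmodType := dsum (fun _ : J => int).
pose Mp (p : {p : nat | prime p}) : zmodType := gprod (fun i => p_component (N i) (val p)).
have Jsupp (c : gprod (fun _ : J => int)) : c \in @fin_supp J (fun=> int).
  by apply/asboolP; apply: sub_finite_set Jfin.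
pose theta (x : gprod N) : F * gprod Mp :=
  (to_dsum (Jsupp (fun j : J => chi (projT1 j) (projT2 j) (x (projT1 j)))),
   fun p i => pi i p (x i)).
have thetaB : zmod_morphism theta.
  move=> x y; congr pair.
    by apply: val_inj; apply: functional_extensionality_dep => j; exact: raddfB.
  apply: functional_extensionality_dep => p; apply: functional_extensionality_dep => i.
  exact: raddfB.
exists F, Mp; split.
- have idB : zmod_morphism (fun x : F => x) by [].
  apply: (@fg_dsum_image _ _ _ (additive_of idB) _ _ Jfin) => [y|_|j []//].
    by exists y.
  by exists 1%N, (fun=> 1) => x; exists (fun=> x); rewrite big_ord1 intz.
- by exists J, idfun; exists id.
- by move=> p; apply: finite_gprod_p_component (valP p) ptor.
- move=> p x; have Mpfin : finite_group (Mp p) by apply: finite_gprod_p_component (valP p) ptor.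
  have [e e0 eP] := finite_group_exponent Mpfin.
  apply/p_torsionP; exists (logn (val p) e); apply: functional_extensionality_dep => i.
  rewrite -[LHS]/(gproj _ i _) raddfMn /=; apply: val_inj; rewrite raddfMn.
  have /p_torsionP [l xl] := valP (x i).
  rewrite -p_part; apply: p_part_exponent xl => //; first exact: valP.
  by rewrite -raddfMn -[x i]/(gproj _ i x) -raddfMn eP !raddf0.
exists (additive_of thetaB); apply: inj_surj_bijective.
  apply: raddf_inj => x x0; apply: functional_extensionality_dep => i; apply: Pinj => [j|p].
    exact: (congr1 (fun z : F * gprod Mp => val z.1 (existT (fun i => 'I_(k i)) i j)) x0).
  exact: (congr1 (fun z : F * gprod Mp => z.2 p i) x0).
move=> [c y].
pose ex i := cid (Psurj i (fun j => val c (existT (fun i => 'I_(k i)) i j)) (fun p => y p i)).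
exists (fun i => projT1 (ex i)); congr pair.
  apply: val_inj; apply: functional_extensionality_dep => -[i j] /=.
  by have [H _] := projT2 (ex i); exact: H.
apply: functional_extensionality_dep => p; apply: functional_extensionality_dep => i.
by have [_ H] := projT2 (ex i); exact: H.
Qed.

Theorem theorem3p6 (I : Type) (N : I -> zmodType)
    (N_nonzero : forall i, nonzero (N i))
    (N_fg : forall i, finitely_generated (N i))
    (N_torsion : exists i, nonzero (torsion_part (N i))) :
  let M : zmodType := gprod N in
  let S : zmodType := dsum N in
  [<-> self_small M;
       small S int /\ (forall p : nat, prime p -> small S (p_component S p));
       (forall p : nat, prime p -> finite_group (p_component S p))
         /\ finitely_generated (torsion_quotient S);
       finite_set [set i | ~ finite_group (N i)]
         /\ (forall p : nat, prime p ->
               finite_set [set i | nonzero (p_component (N i) p)]);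
       forall i, finite_set [set j | nonzero (hom_group (N j) (N i))];
       finite_set [set i | ~ finite_group (N i)]
         /\ (forall i, finite_group (N i) ->
               finite_set [set j | nonzero (hom_group (N i) (N j))]);
       exists (F : zmodType) (Mp : {p : nat | prime p} -> zmodType),
         [/\ finitely_generated F, free_abelian F,
             forall p, finite_group (Mp p),
             forall p, p_group (Mp p) (val p)
           & isomorphic M (F * gprod Mp)%type]].
Proof.
move=> M S; tfae.
- move=> /(self_small_gprod_finiteness N_fg N_torsion) [inf ptor].
  exact: finiteness_small_dsum.
- by move=> [sZ /(small_dsum_finiteness N_fg sZ) [inf ptor]]; exact: finiteness_torsion_quotient.
- by move=> [fp /(torsion_quotient_finiteness N_fg fp)].
- by move=> [inf ptor]; exact: finiteness_hom_to.
- exact: hom_to_finiteness.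
- move=> [inf hfin]; apply: finiteness_decomposition => //.
  exact: hom_from_finiteness.
- move=> [F [Mp [fgF freeF Mfin Mpg iso]]].
  apply: self_small_isomorphic iso _; exact: self_small_free_primary.
Qed.
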